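(* Let $g\in\mathcal H^\infty(B_{\ell_2},\ell_2)$ be continuously extendable to the unit sphere $S_{\ell_2}$ (i.e. $g$ extends to a norm-continuous map $\overline B_{\ell_2}\to\ell_2$, still denoted $g$), such that $g(S_{\ell_2})\subset S_{\ell_2}$. Then the fiber $\mathscr F(g)\subset\mathcal M_{u,\infty}(B_{\ell_2},B_{\ell_2})$ coincides with $\{C_g\}$.
   Context: All spaces are complex; $B_{\ell_2}$, $\overline B_{\ell_2}$, $S_{\ell_2}$ are the open unit ball, closed unit ball and unit sphere of $\ell_2$. $\mathcal A_u(B_{\ell_2})$ is the Banach algebra (sup norm) of holomorphic functions $f:B_{\ell_2}\to\mathbb C$ that are uniformly continuous on $B_{\ell_2}$; each such $f$ extends continuously to $\overline B_{\ell_2}$, and the extension is still denoted $f$. $\mathcal H^\infty(B_{\ell_2})$ is the Banach algebra of bounded holomorphic functions $B_{\ell_2}\to\mathbb C$ with the sup norm; $\mathcal H^\infty(B_{\ell_2},\ell_2)$ is the Banach space of bounded holomorphic maps $B_{\ell_2}\to\ell_2$ with the sup norm. The vector-valued spectrum is $\mathcal M_{u,\infty}(B_{\ell_2},B_{\ell_2})=\{\Phi:\mathcal A_u(B_{\ell_2})\to\mathcal H^\infty(B_{\ell_2})\ \text{nonzero algebra homomorphism}\}$. With $(e_n)$ the canonical basis of $\ell_2$, the projection $\xi:\mathcal M_{u,\infty}(B_{\ell_2},B_{\ell_2})\to\mathcal H^\infty(B_{\ell_2},\ell_2)$ is $\xi(\Phi)(x)=\big(\Phi(\langle\cdot,e_n\rangle)(x)\big)_n$.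 The fiber over $g$ is $\mathscr F(g)=\xi^{-1}(g)$. For $g\in\mathcal H^\infty(B_{\ell_2},\ell_2)$ with $g(B_{\ell_2})\subset\overline B_{\ell_2}$ (which holds for the $g$ in the claim by the maximum principle), the composition homomorphism $C_g\in\mathcal M_{u,\infty}(B_{\ell_2},B_{\ell_2})$ is $C_g(f)=f\circ g$. *)

(* Defs.v *)
From HB Require Import structures.
From mathcomp Require Import all_boot all_order all_algebra.
From mathcomp Require Import all_classical all_reals all_analysis.
From mathcomp Require Import complex.
From mathcomp Require Import ring lra.

Set Implicit Arguments.
Unset Strict Implicit.
Unset Printing Implicit Defensive.

Import Order.TTheory GRing.Theory Num.Theory.
Import numFieldNormedType.Exports.
Import ComplexField.Normc.

Local Open Scope classical_set_scope.
Local Open Scope complex_scope.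
Local Open Scope ring_scope.

(* The library equips abstract numeric fields, but not the concrete type R[i],
   with their own topology and norm. *)
Section complex_normed.
Variable R : realType.
#[non_forgetful_inheritance]
HB.instance Definition _ := GRing.ComAlgebra.copy R[i] R[i]^o.
#[non_forgetful_inheritance]
HB.instance Definition _ := Vector.copy R[i] R[i]^o.
#[non_forgetful_inheritance]
HB.instance Definition _ := NormedModule.copy R[i] R[i]^o.
#[non_forgetful_inheritance]
HB.instance Definition _ := Num.ClosedField.on R[i].
End complex_normed.

Section ell2.
Variable R : realType.
Implicit Types x y : nat -> R[i].

Definition sqmod x : R^nat := fun k => normc (x k) ^+ 2.

Definition sqsummable : {pred nat -> R[i]} :=
  fun x => `[< cvgn (series (sqmod x)) >].

Lemma sqsummableP x : reflect (cvgn (series (sqmod x))) (x \in sqsummable).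
Proof. exact: asboolP. Qed.

Lemma normcE_real (z : R[i]) : `|z| = (normc z)%:C.
Proof. by []. Qed.

Lemma normc_ge0 (z : R[i]) : 0 <= normc z.
Proof. by case: z => a b; exact: sqrtr_ge0. Qed.

Lemma normc_triangle (z w : R[i]) : normc (z + w) <= normc z + normc w.
Proof. by rewrite -lecR rmorphD/=; exact: (@ler_normD _ R[i]). Qed.

Lemma sqmod_ge0 x k : 0 <= sqmod x k.
Proof. exact: sqr_ge0. Qed.

(* (a + b)^2 <= (1 + t) a^2 + (1 + t^-1) b^2 for t > 0 *)
Lemma sqmodD_le (t : R) x y k : 0 < t ->
  sqmod (x + y) k <= ((1 + t) *: sqmod x + (1 + t^-1) *: sqmod y) k.
Proof.
move=> t0; rewrite /sqmod.
have -> : (x + y) k = x k + y k by [].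
have -> (u v : R^nat) (a b : R) : (a *: u + b *: v) k = a * u k + b * v k by [].
set a := normc (x k); set b := normc (y k).
have a0 : 0 <= a by exact: normc_ge0.
have b0 : 0 <= b by exact: normc_ge0.
apply: (@le_trans _ _ ((a + b) ^+ 2)).
  by rewrite ler_pXn2r ?nnegrE ?addr_ge0 ?normc_ge0 ?normc_triangle.
have -> : (1 + t) * a ^+ 2 + (1 + t^-1) * b ^+ 2 =
   (a + b) ^+ 2 + t^-1 * (t * a - b) ^+ 2 by field; rewrite gt_eqF.
by rewrite lerDl mulr_ge0 ?sqr_ge0 ?invr_ge0 ?ltW.
Qed.

Lemma sqsummableD_le (t : R) x y : 0 < t ->
  cvgn (series (sqmod x)) -> cvgn (series (sqmod y)) ->
  cvgn (series (sqmod (x + y))) /\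
  limn (series (sqmod (x + y))) <=
    (1 + t) * limn (series (sqmod x)) + (1 + t^-1) * limn (series (sqmod y)).
Proof.
move=> t0 cx cy.
have czx := is_cvg_seriesZ (k := 1 + t) cx.
have czy := is_cvg_seriesZ (k := 1 + t^-1) cy.
have cz := is_cvg_seriesD czx czy.
have cxy : cvgn (series (sqmod (x + y))).
  apply: series_le_cvg cz => k; first exact: sqmod_ge0.
  - exact: le_trans (sqmod_ge0 (x + y) k) (sqmodD_le x y k t0).
  - exact: sqmodD_le.
split=> //.
have -> : (1 + t) * limn (series (sqmod x)) + (1 + t^-1) * limn (series (sqmod y))
    = limn (series ((1 + t) *: sqmod x + (1 + t^-1) *: sqmod y)).
  by rewrite lim_seriesD// !lim_seriesZ.
by apply: lim_series_le => // k; exact: sqmodD_le.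
Qed.

Lemma sqmodZ (a : R[i]) x : sqmod (a *: x) = (normc a ^+ 2) *: sqmod x.
Proof. by apply/funext => k; rewrite /sqmod normcM exprMn. Qed.

Lemma sqsummable_submod_closed : submod_closed sqsummable.
Proof.
split=> [|a x y /sqsummableP cx /sqsummableP cy]; apply/sqsummableP.
  have -> : series (sqmod 0) = cst 0.
    by apply/funext => n; rewrite /series/= big1// => k _; rewrite /sqmod normc0 expr0n.
  exact: is_cvg_cst.
apply: (sqsummableD_le ltr01 _ cy).1.
by rewrite sqmodZ; exact: is_cvg_seriesZ.
Qed.

HB.instance Definition _ :=
  GRing.isSubmodClosed.Build R[i] (nat -> R[i]) sqsummable
    sqsummable_submod_closed.

Record ell2 : Type := Ell2 { ell2_seq :> nat -> R[i] ; _ : ell2_seq \in sqsummable }.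

HB.instance Definition _ := [isSub for ell2_seq].
HB.instance Definition _ := [Choice of ell2 by <:].
HB.instance Definition _ := [SubChoice_isSubLmodule of ell2 by <:].

Definition ell2_norm (x : ell2) : R := Num.sqrt (limn (series (sqmod x))).

Lemma ell2_cvg (x : ell2) : cvgn (series (sqmod x)).
Proof. by case: x => x /= /sqsummableP. Qed.

Lemma series_sqmod_le (x : ell2) n :
  series (sqmod x) n <= limn (series (sqmod x)).
Proof.
apply: nondecreasing_cvgn_le; last exact: ell2_cvg.
by apply: nondecreasing_series => k _ _; exact: sqmod_ge0.
Qed.

Lemma lim_sqmod_ge0 (x : ell2) : 0 <= limn (series (sqmod x)).
Proof. by apply: le_trans (series_sqmod_le x 0); rewrite /series/= big_geq. Qed.

Lemma ell2_normE (x : ell2) : ell2_norm x ^+ 2 = limn (series (sqmod x)).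
Proof. by rewrite sqr_sqrtr ?lim_sqmod_ge0. Qed.

Lemma ell2_norm_ge0 (x : ell2) : 0 <= ell2_norm x.
Proof. exact: sqrtr_ge0. Qed.

Lemma normc_le_ell2_norm (x : ell2) k : normc (x k) <= ell2_norm x.
Proof.
rewrite -(@ler_pXn2r _ 2) ?nnegrE ?ell2_norm_ge0 ?normc_ge0// ell2_normE.
apply: le_trans (series_sqmod_le x k.+1); rewrite /series/= big_nat_recr//=.
by rewrite lerDr sumr_ge0// => i _; exact: sqmod_ge0.
Qed.

Lemma ell2_norm0_eq0 (x : ell2) : ell2_norm x = 0 -> x = 0.
Proof.
move=> x0; apply/val_inj/funext => k; apply: eq0_normc.
by apply/eqP; rewrite eq_le normc_ge0 -x0 normc_le_ell2_norm.
Qed.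

Lemma ell2_normD (x y : ell2) :
  ell2_norm (x + y) <= ell2_norm x + ell2_norm y.
Proof.
have [->|x0] := eqVneq x 0; first by rewrite add0r lerDr ell2_norm_ge0.
have [->|y0] := eqVneq y 0; first by rewrite addr0 lerDl ell2_norm_ge0.
have nx : 0 < ell2_norm x.
  by rewrite lt_neqAle ell2_norm_ge0 eq_sym andbT; apply: contra_neq x0;
     exact: ell2_norm0_eq0.
have ny : 0 < ell2_norm y.
  by rewrite lt_neqAle ell2_norm_ge0 eq_sym andbT; apply: contra_neq y0;
     exact: ell2_norm0_eq0.
rewrite -(@ler_pXn2r _ 2) ?nnegrE ?addr_ge0 ?ell2_norm_ge0// ell2_normE.
have [_] := sqsummableD_le (divr_gt0 ny nx) (@ell2_cvg x) (@ell2_cvg y).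
rewrite -!ell2_normE => /le_trans; apply.
rewrite le_eqVlt; apply/orP; left; apply/eqP.
by field; rewrite !gt_eqF.
Qed.

Lemma ell2_normZ (a : R[i]) (x : ell2) :
  ell2_norm (a *: x) = normc a * ell2_norm x.
Proof.
rewrite /ell2_norm (_ : sqmod (a *: x) = (normc a ^+ 2) *: sqmod x); last first.
  exact: sqmodZ.
rewrite lim_seriesZ; last exact: ell2_cvg.
by rewrite sqrtrM ?sqr_ge0// sqrtr_sqr ger0_norm ?normc_ge0.
Qed.

Lemma ell2_normCD (x y : ell2) :
  (ell2_norm (x + y))%:C <= (ell2_norm x)%:C + (ell2_norm y)%:C.
Proof. by rewrite -rmorphD lecR ell2_normD. Qed.

Lemma ell2_normCZ (a : R[i]) (x : ell2) :
  (ell2_norm (a *: x))%:C = `|a| * (ell2_norm x)%:C.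
Proof. by rewrite ell2_normZ rmorphM. Qed.

Lemma ell2_normC0_eq0 (x : ell2) : (ell2_norm x)%:C = 0 -> x = 0.
Proof. by move=> /complexI; exact: ell2_norm0_eq0. Qed.

HB.instance Definition _ := Lmodule_isNormed.Build R[i] ell2
  ell2_normCD ell2_normCZ ell2_normC0_eq0.

Lemma ell2_normCE (x : ell2) : `|x| = (ell2_norm x)%:C.
Proof. by []. Qed.

End ell2.

Section inner_product.
Variable R : realType.

(* Linear in the first variable. *)
Definition ell2_dot (x y : ell2 R) : R[i] :=
  limn (series (fun k => x k * (y k)^*)).

Definition canonical_seq (n : nat) : nat -> R[i] := fun k => (k == n)%:R.

Lemma canonical_seq_sqsummable n : canonical_seq n \in @sqsummable R.
Proof.
apply/sqsummableP/cvg_ex; exists 1; apply: (@cvg_trans _ (cst 1 @ \oo)).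
  apply: near_eq_cvg; near=> m; rewrite /series/=.
  have nm : (n < m)%N by near: m; exact: nbhs_infty_gt.
  rewrite big_mkord (bigD1 (Ordinal nm))//=.
  rewrite big1 ?addr0 => [|i /negP in_].
    by rewrite /sqmod /canonical_seq eqxx normc1 expr1n.
  rewrite /sqmod /canonical_seq; case: eqP => [e|_]; last by rewrite normc0 expr0n.
  by case: in_; apply/eqP/val_inj.
exact: cvg_cst.
Unshelve. all: by end_near. Qed.

Definition canonical_vec (n : nat) : ell2 R :=
  Ell2 (canonical_seq_sqsummable n).

Lemma ell2_dot_canonical (x : ell2 R) n : ell2_dot x (canonical_vec n) = x n.
Proof.
apply: cvg_lim; first exact: norm_hausdorff.
apply: (@cvg_trans _ (cst (x n) @ \oo)); last exact: cvg_cst.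
apply: near_eq_cvg; near=> m; rewrite /series/=.
have nm : (n < m)%N by near: m; exact: nbhs_infty_gt.
rewrite big_mkord (bigD1 (Ordinal nm))//=.
rewrite /canonical_seq big1 ?addr0 => [|i /negP in_].
  by rewrite eqxx conjC1 mulr1.
case: eqP => [e|_]; last by rewrite conjC0 mulr0.
by case: in_; apply/eqP/val_inj.
Unshelve. all: by end_near. Qed.

End inner_product.

Lemma near_eq_differentiable (K : numFieldType) (V W : normedModType K)
    (f g : V -> W) (x : V) :
  (\forall y \near x, f y = g y) -> differentiable f x -> differentiable g x.
Proof.
move=> fg /diff_locallyP[dfc dfo].
have gx : g x = f x by rewrite (nbhs_singleton fg).
have dgo : g \o shift x = cst (g x) + 'd f x +o_ 0 id.
  apply/eqaddoP => e e0.
  have /eqaddoP/(_ e e0) := dfo.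
  move: fg; rewrite (near_shift 0) subr0 => fg.
  apply: filterS2 fg => z /= fgz.
  rewrite gx [X in `|X| <= _ -> _]/(f (z + x) - (f x + 'd f x z)) fgz.
  exact.
have dE := diff_unique dfc dgo.
by apply/diff_locallyP; rewrite dE.
Qed.

Section unit_ball.
Variable R : realType.

Definition unit_ball := {x : ell2 R | `|x| < 1}.

Definition in_ball (x : ell2 R) (x1 : `|x| < 1) : unit_ball := exist _ x x1.

Definition zero_ext (V : zmodType) (f : unit_ball -> V) : ell2 R -> V :=
  fun x => oapp f 0 (insub x).

Lemma zero_extE (V : zmodType) (f : unit_ball -> V) (x : unit_ball) :
  zero_ext f (val x) = f x.
Proof. by rewrite /zero_ext valK. Qed.

Lemma nbhs_unit_ball (x : unit_ball) : nbhs (val x) [set y : ell2 R | `|y| < 1].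
Proof.
have x1 : `|val x| < 1 by case: x.
have idx : id y @[y --> val x] --> val x by exact: cvg_id.
exact: (cvgr_norm_lt _ idx _ x1).
Qed.

Lemma near_zero_ext (V : zmodType) (f : unit_ball -> V) (F : ell2 R -> V)
    (x : unit_ball) :
  (forall y, f y = F (val y)) -> \forall y \near val x, F y = zero_ext f y.
Proof.
move=> fF; apply: filterS (nbhs_unit_ball x) => y /= y1.
by rewrite -[y]/(val (in_ball y1)) zero_extE fF.
Qed.

(* On the open set [`|x| < 1] differentiability does not depend on the values
   chosen outside the ball. *)
Definition holomorphic (V : normedModType R[i]) (f : unit_ball -> V) :=
  forall x : unit_ball, differentiable (zero_ext f) (val x).

Lemma holomorphicP (V : normedModType R[i]) (f : unit_ball -> V)
    (F : ell2 R -> V) : (forall x, f x = F (val x)) ->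
  (forall x : unit_ball, differentiable F (val x)) -> holomorphic f.
Proof.
by move=> fF dF x; exact: near_eq_differentiable (near_zero_ext x fF) (dF x).
Qed.

Lemma holomorphic_cst (V : normedModType R[i]) (a : V) :
  holomorphic (fun=> a).
Proof. by apply: (holomorphicP (F := cst a)). Qed.

Lemma holomorphic_lin (V : normedModType R[i]) (a : R[i])
    (f g : unit_ball -> V) :
  holomorphic f -> holomorphic g -> holomorphic (a *: f + g).
Proof.
move=> hf hg; apply: (holomorphicP (F := a *: zero_ext f + zero_ext g)) => x.
  by rewrite [RHS]/(a *: zero_ext f (val x) + zero_ext g (val x)) !zero_extE.
by apply: differentiableD => //; exact: differentiableZ.
Qed.

Lemma holomorphicM (f g : unit_ball -> R[i]) :
  holomorphic f -> holomorphic g -> holomorphic (f * g).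
Proof.
move=> hf hg; apply: (holomorphicP (F := zero_ext f * zero_ext g)) => x.
  by rewrite [RHS]/(zero_ext f (val x) * zero_ext g (val x)) !zero_extE.
exact: differentiableM.
Qed.

Definition bounded_on_ball (V : normedModType R[i]) (f : unit_ball -> V) :=
  exists M : R[i], forall x, `|f x| <= M.

Lemma bounded_on_ball_lin (V : normedModType R[i]) (a : R[i])
    (f g : unit_ball -> V) :
  bounded_on_ball f -> bounded_on_ball g -> bounded_on_ball (a *: f + g).
Proof.
move=> [M fM] [N gN]; exists (`|a| * M + N) => x.
rewrite [_ x]/(a *: f x + g x) (le_trans (ler_normD _ _))// lerD//.
by rewrite normrZ ler_wpM2l.
Qed.

Lemma bounded_on_ballM (f g : unit_ball -> R[i]) :
  bounded_on_ball f -> bounded_on_ball g -> bounded_on_ball (f * g).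
Proof.
move=> [M fM] [N gN]; exists (M * N) => x.
by rewrite [_ x]/(f x * g x) normrM ler_pM.
Qed.

Definition unif_continuous_on_ball (f : unit_ball -> R[i]) :=
  forall e : R[i], 0 < e -> exists2 d : R[i], 0 < d &
    forall x y : unit_ball, `|val x - val y| < d -> `|f x - f y| < e.

Lemma unif_continuous_lin (a : R[i]) (f g : unit_ball -> R[i]) :
  unif_continuous_on_ball f -> unif_continuous_on_ball g ->
  unif_continuous_on_ball (a *: f + g).
Proof.
move=> uf ug e e0.
have a0 : 0 < `|a| + 1 by rewrite ltr_wpDl.
have [d d0 fd] := uf (e / 2 / (`|a| + 1)) ltac:(by rewrite !divr_gt0).
have [d' d'0 gd] := ug (e / 2) ltac:(by rewrite divr_gt0).
have dd' : d >=< d' by rewrite real_comparable ?gtr0_real.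
exists (Num.min d d') => [|x y]; first by rewrite comparable_lt_min ?d0.
rewrite comparable_lt_min// => /andP[xyd xyd'].
rewrite -[(_ + _) x]/(a * f x + g x) -[(_ + _) y]/(a * f y + g y).
rewrite (_ : _ - _ = a * (f x - f y) + (g x - g y)); last by ring.
rewrite (le_lt_trans (ler_normD _ _))// (splitr e) ler_ltD ?gd//.
rewrite normrM (@le_trans _ _ ((`|a| + 1) * `|f x - f y|))//.
  by rewrite ler_wpM2r// lerDl.
by rewrite mulrC -ler_pdivlMr// ltW// fd.
Qed.

Lemma unif_continuous_bounded (f : unit_ball -> R[i]) :
  unif_continuous_on_ball f -> bounded_on_ball f.
Proof.
move=> /(_ 1 ltr01)[d d0 fd].
have n0 : `|0 : ell2 R| < 1 by rewrite normr0.
pose o := in_ball n0.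
have [D D0 dE] : exists2 D : R, 0 < D & d = D%:C.
  exists (complex.Re d); first by move: d0; rewrite ltcE => /andP[].
  by rewrite RRe_real// gtr0_real.
pose N := (Num.truncn D^-1).+1.
have ND : N%:R^-1 < d.
  rewrite dE -[_%:R](rmorph_nat (real_complex R)) -fmorphV ltcR.
  by rewrite invf_plt ?posrE// truncnS_gt.
exists (`|f o| + N%:R) => x.
have N0 : (0 : R[i]) < N%:R by rewrite ltr0n.
have scale_lt k : (k <= N)%N -> `|(k%:R / N%:R : R[i]) *: val x| < 1.
  move=> kN; rewrite normrZ; have x1 : `|val x| < 1 by case: (x).
  apply: le_lt_trans x1.
  rewrite ler_piMl// ger0_norm ?divr_ge0//.
  by rewrite ler_pdivrMr// mul1r ler_nat.
have step k (kN : (k <= N)%N) :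
    `|f (in_ball (scale_lt k kN))| <= `|f o| + k%:R.
  elim: k kN => [|k IH] kN.
    rewrite addr0; set z := in_ball _.
    by have -> : z = o; [apply/val_inj; rewrite /= mul0r scale0r|].
  have kN' := ltnW kN; apply: le_trans (_ : 1 + (`|f o| + k%:R) <= _); last first.
    by rewrite -natr1 addrC addrA.
  rewrite -(subrK (f (in_ball (scale_lt k kN'))) (f _)).
  rewrite (le_trans (ler_normD _ _))// lerD ?IH// ltW// fd//=.
  rewrite -scalerBl -mulrBl -natr1 addrAC subrr add0r mul1r normrZ.
  rewrite ger0_norm ?invr_ge0//; apply: le_lt_trans ND.
  by rewrite ler_piMr ?invr_ge0// ltW//; case: (x).
have := step N (leqnn N); set z := in_ball _.
suff -> : z = x by [].
by apply/val_inj; rewrite /= divff ?scale1r// gt_eqF.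
Qed.

Lemma unif_continuousM (f g : unit_ball -> R[i]) :
  unif_continuous_on_ball f -> unif_continuous_on_ball g ->
  unif_continuous_on_ball (f * g).
Proof.
move=> uf ug e e0.
have [M fM] := unif_continuous_bounded uf.
have [N gN] := unif_continuous_bounded ug.
have n0 : `|0 : ell2 R| < 1 by rewrite normr0.
pose o := in_ball n0.
have M0 : 0 <= M by exact: le_trans (fM o).
have N0 : 0 <= N by exact: le_trans (gN o).
have M1 : 0 < M + 1 by rewrite ltr_wpDl.
have N1 : 0 < N + 1 by rewrite ltr_wpDl.
have [d d0 fd] := uf (e / 2 / (N + 1)) ltac:(by rewrite !divr_gt0).
have [d' d'0 gd] := ug (e / 2 / (M + 1)) ltac:(by rewrite !divr_gt0).
have dd' : d >=< d' by rewrite real_comparable ?gtr0_real.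
exists (Num.min d d') => [|x y]; first by rewrite comparable_lt_min ?d0.
rewrite comparable_lt_min// => /andP[xyd xyd'].
rewrite -[(_ * _) x]/(f x * g x) -[(_ * _) y]/(f y * g y).
rewrite (_ : _ - _ = (f x - f y) * g x + f y * (g x - g y)); last by ring.
rewrite (le_lt_trans (ler_normD _ _))// (splitr e) !normrM ler_ltD//.
  apply: (@le_trans _ _ (`|f x - f y| * (N + 1))).
    by rewrite ler_wpM2l// (le_trans (gN x))// lerDl.
  by rewrite -ler_pdivlMr// ltW// fd.
apply: (@le_lt_trans _ _ ((M + 1) * `|g x - g y|)).
  by rewrite ler_wpM2r// (le_trans (fM y))// lerDl.
by rewrite mulrC -ltr_pdivlMr// gd.
Qed.

Lemma bounded_on_ball_cst (V : normedModType R[i]) (a : V) :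
  bounded_on_ball (fun=> a).
Proof. by exists `|a|. Qed.

Lemma unif_continuous_cst (a : R[i]) : unif_continuous_on_ball (fun=> a).
Proof. by move=> e e0; exists 1 => // x y _; rewrite subrr normr0. Qed.

End unit_ball.

Section algebras.
Variable R : realType.
Local Notation B := (unit_ball R).

Definition Au_pred : {pred B -> R[i]} :=
  fun f => `[< holomorphic f /\ unif_continuous_on_ball f >].

Definition Hoo_pred : {pred B -> R[i]} :=
  fun f => `[< holomorphic f /\ bounded_on_ball f >].

Lemma Au_predP f :
  reflect (holomorphic f /\ unif_continuous_on_ball f) (f \in Au_pred).
Proof. exact: asboolP. Qed.

Lemma Hoo_predP f :
  reflect (holomorphic f /\ bounded_on_ball f) (f \in Hoo_pred).
Proof. exact: asboolP. Qed.

Lemma Au_submod_closed : submod_closed Au_pred.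
Proof.
split=> [|a f g /Au_predP[hf uf] /Au_predP[hg ug]]; apply/Au_predP; split.
- exact: holomorphic_cst.
- exact: unif_continuous_cst.
- exact: holomorphic_lin.
- exact: unif_continuous_lin.
Qed.

Lemma Au_mulr_closed : mulr_closed Au_pred.
Proof.
split=> [|f g /Au_predP[hf uf] /Au_predP[hg ug]]; apply/Au_predP; split.
- exact: holomorphic_cst.
- exact: unif_continuous_cst.
- exact: holomorphicM.
- exact: unif_continuousM.
Qed.

Lemma Hoo_submod_closed : submod_closed Hoo_pred.
Proof.
split=> [|a f g /Hoo_predP[hf uf] /Hoo_predP[hg ug]]; apply/Hoo_predP; split.
- exact: holomorphic_cst.
- exact: bounded_on_ball_cst.
- exact: holomorphic_lin.
- exact: bounded_on_ball_lin.
Qed.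

Lemma Hoo_mulr_closed : mulr_closed Hoo_pred.
Proof.
split=> [|f g /Hoo_predP[hf uf] /Hoo_predP[hg ug]]; apply/Hoo_predP; split.
- exact: holomorphic_cst.
- exact: bounded_on_ball_cst.
- exact: holomorphicM.
- exact: bounded_on_ballM.
Qed.

HB.instance Definition _ :=
  GRing.isSubmodClosed.Build R[i] (B -> R[i]) Au_pred Au_submod_closed.
HB.instance Definition _ :=
  GRing.isMulClosed.Build (B -> R[i]) Au_pred Au_mulr_closed.
HB.instance Definition _ :=
  GRing.isSubmodClosed.Build R[i] (B -> R[i]) Hoo_pred Hoo_submod_closed.
HB.instance Definition _ :=
  GRing.isMulClosed.Build (B -> R[i]) Hoo_pred Hoo_mulr_closed.

Fact Au_subring_closed : subring_closed Au_pred.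
Proof. by split; [exact: rpred1|exact: rpredB|exact: rpredM]. Qed.

Fact Hoo_subring_closed : subring_closed Hoo_pred.
Proof. by split; [exact: rpred1|exact: rpredB|exact: rpredM]. Qed.

Record Au : Type := MkAu { Au_fun :> B -> R[i] ; _ : Au_fun \in Au_pred }.
HB.instance Definition _ := [isSub for Au_fun].
HB.instance Definition _ := [Choice of Au by <:].
HB.instance Definition _ := [SubChoice_isSubLmodule of Au by <:].
HB.instance Definition _ :=
  GRing.SubZmodule_isSubPzRing.Build (B -> R[i]) Au_pred Au Au_subring_closed.
HB.instance Definition _ :=
  GRing.SubPzRing_isSubComPzRing.Build (B -> R[i]) Au_pred Au.

Record Hoo : Type := MkHoo { Hoo_fun :> B -> R[i] ; _ : Hoo_fun \in Hoo_pred }.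
HB.instance Definition _ := [isSub for Hoo_fun].
HB.instance Definition _ := [Choice of Hoo by <:].
HB.instance Definition _ := [SubChoice_isSubLmodule of Hoo by <:].
HB.instance Definition _ :=
  GRing.SubZmodule_isSubPzRing.Build (B -> R[i]) Hoo_pred Hoo Hoo_subring_closed.
HB.instance Definition _ :=
  GRing.SubPzRing_isSubComPzRing.Build (B -> R[i]) Hoo_pred Hoo.


Lemma holomorphic_coord n :
  holomorphic (fun x : B => ell2_dot (val x) (canonical_vec R n)).
Proof.
pose c (x : ell2 R) : R[i] := x n.
have clin : linear c by [].
pose C : {linear ell2 R -> R[i]} :=
  HB.pack c (GRing.isLinear.Build R[i] (ell2 R) R[i] *:%R c clin).
have Ccont : continuous C.
  apply: bounded_linear_continuous; apply/bounded_funP => r; exists r => x.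
  by apply: le_trans; rewrite normcE_real ell2_normCE lecR normc_le_ell2_norm.
apply: (holomorphicP (F := C)) => x; first exact: ell2_dot_canonical.
exact: linear_differentiable.
Qed.

Lemma unif_continuous_coord n : unif_continuous_on_ball
  (fun x : B => ell2_dot (val x) (canonical_vec R n)).
Proof.
move=> e e0; exists e => // x y; apply: le_lt_trans.
rewrite !ell2_dot_canonical -[_ - _]/((val x - val y : ell2 R) n).
by rewrite normcE_real ell2_normCE lecR normc_le_ell2_norm.
Qed.

Lemma coord_Au n :
  (fun x : B => ell2_dot (val x) (canonical_vec R n)) \in Au_pred.
Proof.
apply/Au_predP; split; [exact: holomorphic_coord|exact: unif_continuous_coord].
Qed.

Definition coord (n : nat) : Au := MkAu (coord_Au n).

(* The continuous extension of [f] to the closed ball, as a limit from inside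
   the open ball; meaningful only at points [y] with [`|y| <= 1]. *)
Definition Au_ext (f : Au) (y : ell2 R) : R[i] :=
  lim (zero_ext f z @[z --> within [set z | `|z| < 1] (nbhs y)]).

Lemma Au_ext_ball (f : Au) (x : B) : Au_ext f (val x) = f x.
Proof.
have [hf _] : holomorphic f /\ unif_continuous_on_ball f.
  by case: f => f /= /Au_predP.
have fx : zero_ext f z @[z --> val x] --> f x.
  have := differentiable_continuous (hf x).
  by rewrite /prop_for /continuous_at zero_extE.
rewrite /Au_ext within_interior; last exact: nbhs_unit_ball.
by apply: cvg_lim fx; exact: norm_hausdorff.
Qed.

(* Algebra homomorphisms are not required to be unital, only nonzero. *)
Definition spectrum : set (Au -> Hoo) :=
  [set Phi : Au -> Hoo |
    [/\ linear Phi, {morph Phi : f h / f * h} & exists f, Phi f != 0]].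

(* [xi Phi x] is kept as a bare sequence of scalars, so that no proof of its
   square summability is needed; since [ell2] is a subtype of sequences,
   equality with [g x] in [fiber] is equality in ell2. *)
Definition xi (Phi : Au -> Hoo) : B -> nat -> R[i] :=
  fun x n => Phi (coord n) x.

Definition fiber (g : B -> ell2 R) : set (Au -> Hoo) :=
  [set Phi : Au -> Hoo |
    spectrum Phi /\ forall x, xi Phi x = g x :> (nat -> R[i])].

(* [Cg] is the composition homomorphism f |-> f \o g, where [f] stands for its
   extension to the closed ball; this only makes sense when [g] takes its
   values in the closed ball. *)
Definition is_composition_hom (g : B -> ell2 R) (Cg : Au -> Hoo) :=
  (forall x, `|g x| <= 1) /\ forall f x, Cg f x = Au_ext f (g x).

Definition Hoo_ell2 (g : B -> ell2 R) := holomorphic g /\ bounded_on_ball g.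

End algebras.

(* Main.v *)
(* Evaluating a homomorphism Phi of the fiber at a point x gives a character of
   A_u whose coordinates are those of g(x). If a lies on the unit sphere, the
   functions ((1 + <z, a>) / 2)^n peak at a, so a character with coordinates
   close to a takes at f a value close to f(a). Hence Phi(f) - f o g tends to 0
   at every point of the sphere, and the maximum principle makes it vanish.

   The maximum principle on the ball follows from the mean value property on the
   circles x + z d with d orthogonal to x and |d| = 1, because
   |x + z d|^2 = |x|^2 + |z|^2. The mean value property is Goursat's theorem in
   polar coordinates.

   C_g is well defined because |g| <= 1 by the maximum principle, and g is
   constant as soon as |g| = 1 at some point of the open ball. *)
From HB Require Import structures.
Require Import Defs.
From mathcomp Require Import all_boot all_order all_algebra.
From mathcomp Require Import all_classical all_reals all_analysis.
From mathcomp Require Import complex.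
From mathcomp Require Import ring lra.
Import Order.TTheory GRing.Theory Num.Theory.
Import numFieldNormedType.Exports.
Import ComplexField.Normc.
Local Open Scope classical_set_scope.
Local Open Scope complex_scope.
Local Open Scope ring_scope.

(** * Goursat on rectangles *)

Section SegmentIntegral.
Variable R : realType.
Implicit Types (a b c x y w h r t : R) (f : R -> R).

(** Over an interior point the coordinates of a character do not determine it: a limit along a free
    ultrafilter of the evaluations at $e_n/2$ has the coordinates of the evaluation at 0, yet takes
    the value 1/4 on $\sum_k z_k^2$. So for a single [x] with [|g x| < 1] the coordinates do not pin
    down [Phi f x]; the holomorphic dependence on [x] has to carry the information in from the
    sphere. There [Phi f] has no values, since a bounded holomorphic function need not extend. Hence
    the peaking argument is quantitative, covering every character with coordinates near [a], and
    the maximum principle takes boundary bounds of limsup type. The unit sphere of $\ell_2$ is not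
    norm compact, so such bounds become uniform only along compact sets such as circles. Continuity
    of [Phi] is not part of the data; contractivity of characters comes from invertibility in the
    algebra. *)

Definition seg_int a b f : R := \int[@lebesgue_measure R]_(x in `[a, b]) f x.

Lemma seg_integrable a b f : {within `[a, b], continuous f} ->
  (@lebesgue_measure R).-integrable `[a, b] (EFin \o f).
Proof.
by move=> cf; apply: continuous_compact_integrable => //; exact: segment_compact.
Qed.

Lemma seg_int_split a b c f : a <= c -> c <= b ->
  {within `[a, b], continuous f} ->
  seg_int a b f = seg_int a c f + seg_int c b f.
Proof.
move=> ac cb cf; have itf := seg_integrable _ _ _ cf.
have := @Rintegral_itvB _ f (BLeft a) (BRight b) c itf.
rewrite !bnd_simp => /(_ ac cb) E.
rewrite /seg_int -(subrK (\int[lebesgue_measure]_(t in `[a, c]) f t)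
  (\int[lebesgue_measure]_(t in `[a, b]) f t)) E addrC; congr (_ + _).
apply: Rintegral_itv_obnd_cbnd; apply: integrableS itf => //.
by apply: subset_itvr; rewrite bnd_simp.
Qed.

Lemma seg_int_cst a b c : a <= b -> seg_int a b (cst c) = c * (b - a).
Proof.
move=> ab; rewrite /seg_int Rintegral_cst//; congr (_ * _).
rewrite [X in fine X](@lebesgue_measure_itv R `[a, b])/= lte_fin.
by move: ab; rewrite le_eqVlt => /predU1P[->|->//]; rewrite ltxx subrr.
Qed.

Lemma seg_intB a b f f' :
  {within `[a, b], continuous f} -> {within `[a, b], continuous f'} ->
  seg_int a b (fun x => f x - f' x) = seg_int a b f - seg_int a b f'.
Proof. by move=> cf cf'; apply: RintegralB => //; exact: seg_integrable. Qed.

Lemma le_seg_int a b f f' :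
  {within `[a, b], continuous f} -> {within `[a, b], continuous f'} ->
  (forall x, a <= x <= b -> f x <= f' x) -> seg_int a b f <= seg_int a b f'.
Proof.
by move=> cf cf' ff'; apply: le_Rintegral => //; exact: seg_integrable.
Qed.

Lemma within_continuous_cst a b c : {within `[a, b], continuous (cst c : R -> R)}.
Proof. by apply: continuous_subspaceT => x; exact: cvg_cst. Qed.

Lemma seg_int_near_cst a b c m f : a <= b -> {within `[a, b], continuous f} ->
  (forall x, a <= x <= b -> `|f x - c| <= m) ->
  `|seg_int a b f - c * (b - a)| <= m * (b - a).
Proof.
move=> ab cf fm.
have cc k := within_continuous_cst a b k.
have le1 : seg_int a b f <= (c + m) * (b - a).
  rewrite -seg_int_cst//; apply: le_seg_int => // x /fm.
  by rewrite ler_norml /= => /andP[]; lra.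
have le2 : (c - m) * (b - a) <= seg_int a b f.
  rewrite -seg_int_cst//; apply: le_seg_int => // x /fm.
  by rewrite ler_norml /= => /andP[]; lra.
by rewrite ler_norml; apply/andP; split; lra.
Qed.

(** Nested rectangles, detached from integrals: [Q n x y] is a property of the rectangle with lower
    left corner [(x, y)] and sides [w / 2 ^+ n], [h / 2 ^+ n]. The booleans select one of its
    quarters, and [(r, t)] is a point common to all selected rectangles. *)
Lemma bisect_rectangle (Q : nat -> R -> R -> Prop) x0 y0 w h :
  0 <= w -> 0 <= h -> Q 0%N x0 y0 ->
  (forall n x y, Q n x y -> exists i j : bool,
     Q n.+1 (x + i%:R * (w / 2 ^+ n.+1)) (y + j%:R * (h / 2 ^+ n.+1))) ->
  exists r t, forall n, exists x y,
    [/\ Q n x y, x <= r <= x + w / 2 ^+ n & y <= t <= y + h / 2 ^+ n].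
Proof.
move=> w0 h0 Q0 QS.
(* Dependent choice; the default [p] of [xget] is never returned along the sequence, because [QS]
   keeps the set nonempty. *)
pose nxt n (p : R * R) : R * R := xget p
  [set q | Q n.+1 q.1 q.2 /\ exists i j : bool,
     q = (p.1 + i%:R * (w / 2 ^+ n.+1), p.2 + j%:R * (h / 2 ^+ n.+1))].
pose p := fix p n : R * R := if n is m.+1 then nxt m (p m) else (x0, y0).
have Qp n : Q n (p n).1 (p n).2.
  elim: n => //= n IH; rewrite /nxt; case: xgetP => [q _ []//|/=].
  have [i [j Qij]] := QS _ _ _ IH.
  move=> /(_ ((p n).1 + i%:R * (w / 2 ^+ n.+1), (p n).2 + j%:R * (h / 2 ^+ n.+1))).
  by case; split; [exact: Qij|exists i, j].
have pS n : exists i j : bool, p n.+1 =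
    ((p n).1 + i%:R * (w / 2 ^+ n.+1), (p n).2 + j%:R * (h / 2 ^+ n.+1)).
  rewrite /= /nxt; case: xgetP => [q _ []//|/=].
  have [i [j Qij]] := QS _ _ _ (Qp n).
  move=> /(_ ((p n).1 + i%:R * (w / 2 ^+ n.+1), (p n).2 + j%:R * (h / 2 ^+ n.+1))).
  by case; split; [exact: Qij|exists i, j].
(* One coordinate at a time: the intervals from [u n] to [u n + v / 2 ^+ n] are nested, and the
   supremum of the left ends lies in all of them. *)
have lim1 (u : nat -> R) v : 0 <= v ->
    (forall n, exists i : bool, u n.+1 = u n + i%:R * (v / 2 ^+ n.+1)) ->
    exists l, forall n, u n <= l <= u n + v / 2 ^+ n.
  move=> v0 uS.
  have v2 n : 0 <= v / 2 ^+ n by rewrite divr_ge0// exprn_ge0.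
  have vS n : v / 2 ^+ n = v / 2 ^+ n.+1 + v / 2 ^+ n.+1.
    by rewrite exprS; field; rewrite expf_neq0// pnatr_eq0.
  have un n : u n <= u n.+1 /\ u n.+1 + v / 2 ^+ n.+1 <= u n + v / 2 ^+ n.
    have := v2 n.+1; have := vS n; have [[] ->] := uS n => /=;
      by rewrite ?mul1r ?mul0r => ? ?; split; lra.
  have unm n m : u n <= u (n + m)%N /\ u (n + m)%N + v / 2 ^+ (n + m) <= u n + v / 2 ^+ n.
    elim: m => [|m [IH1 IH2]]; first by rewrite addn0.
    have [h1 h2] := un (n + m)%N; rewrite addnS; split.
      exact: le_trans IH1 h1.
    exact: le_trans h2 IH2.
  have unM n m : u n <= u m + v / 2 ^+ m.
    case: (leqP m n) => [mn|nm].
      have [_] := unm m (n - m)%N; rewrite subnKC//.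
      by apply: le_trans; rewrite lerDl.
    have [+ _] := unm n (m - n)%N; rewrite subnKC ?(ltnW nm)// => h1.
    by apply: le_trans h1 _; rewrite lerDl.
  exists (sup (range u)) => n; apply/andP; split.
    apply: ub_le_sup; last by exists n.
    by exists (u 0%N + v / 2 ^+ 0) => _ [k _ <-].
  apply: ge_sup; first by exists (u 0%N); exists 0%N.
  by move=> _ [k _ <-].
have [r rP] := lim1 (fst \o p) w w0
  ltac:(move=> n; have [i [j /= ->]] := pS n; by exists i).
have [t tP] := lim1 (snd \o p) h h0
  ltac:(move=> n; have [i [j /= ->]] := pS n; by exists j).
by exists r, t => n; exists (p n).1, (p n).2; split => //; [exact: rP|exact: tP].
Qed.

End SegmentIntegral.

Section Rectangle.
Variable R : realType.
Implicit Types (a b c x y w h r t : R) (f : R -> R).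

Lemma within_continuous_sub a b a' b' f : a <= a' -> b' <= b ->
  {within `[a, b], continuous f} -> {within `[a', b'], continuous f}.
Proof.
move=> aa' bb'; apply: continuous_subspaceW.
by apply: subset_itv; rewrite bnd_simp.
Qed.

(** Circulation of the form [A dr + D dt] along the positively oriented boundary: bottom minus top
    for [A], right minus left for [D]. *)
Definition rect_int (A D : R -> R -> R) x x' y y' : R :=
  seg_int R x x' (A ^~ y) - seg_int R x x' (A ^~ y') +
  (seg_int R y y' (D x') - seg_int R y y' (D x)).

(** Each inner side is traversed twice, in opposite directions. *)
Lemma rect_int_quarters (A D : R -> R -> R) a a' b b' x m x' y n y' :
  (forall t, b <= t <= b' -> {within `[a, a'], continuous (A ^~ t)}) ->
  (forall r, a <= r <= a' -> {within `[b, b'], continuous (D r)}) ->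
  [/\ a <= x, x <= m, m <= x' & x' <= a'] ->
  [/\ b <= y, y <= n, n <= y' & y' <= b'] ->
  rect_int A D x x' y y' =
  rect_int A D x m y n + rect_int A D m x' y n +
  (rect_int A D x m n y' + rect_int A D m x' n y').
Proof.
move=> cA cD [ax xm mx xa] [by_ yn ny yb].
have sA t : b <= t <= b' ->
    seg_int R x x' (A ^~ t) = seg_int R x m (A ^~ t) + seg_int R m x' (A ^~ t).
  by move=> /cA ct; apply: seg_int_split => //; exact: within_continuous_sub ct.
have sD r : a <= r <= a' ->
    seg_int R y y' (D r) = seg_int R y n (D r) + seg_int R n y' (D r).
  by move=> /cD ct; apply: seg_int_split => //; exact: within_continuous_sub ct.
rewrite /rect_int !sA ?sD; try (by apply/andP; split; clear -ax xm mx xa by_ yn ny yb; lra).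
ring.
Qed.

(** The common slope [k] expresses that the form is closed to first order: [A] contributes [- k]
    times the area and [D] contributes [k] times the area. These cancel, leaving only the
    remainders, bounded by [m] on each pair of sides. *)
Lemma rect_int_small (A D : R -> R -> R) x x' y y' k m :
  x <= x' -> y <= y' ->
  {within `[x, x'], continuous (A ^~ y)} ->
  {within `[x, x'], continuous (A ^~ y')} ->
  {within `[y, y'], continuous (D x)} -> {within `[y, y'], continuous (D x')} ->
  (forall r, x <= r <= x' -> `|A r y' - A r y - k * (y' - y)| <= m) ->
  (forall t, y <= t <= y' -> `|D x' t - D x t - k * (x' - x)| <= m) ->
  `|rect_int A D x x' y y'| <= m * ((x' - x) + (y' - y)).
Proof.
move=> xx yy cA cA' cD cD' mA mD; rewrite /rect_int.
rewrite -!seg_intB//.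
have cB a b f f' : {within `[a, b], continuous f} ->
    {within `[a, b], continuous f'} ->
    {within `[a, b], continuous (fun x => f x - f' x)}.
  by move=> cf cf' z; apply: cvgB; [exact: cf|exact: cf'].
have h1 : `|seg_int R x x' (fun r => A r y - A r y') - (- k * (y' - y)) * (x' - x)|
    <= m * (x' - x).
  apply: seg_int_near_cst => //; first exact: cB.
  by move=> r /mA; rewrite -normrN; congr (`|_| <= _); ring.
have h2 : `|seg_int R y y' (fun t => D x' t - D x t) - (k * (x' - x)) * (y' - y)|
    <= m * (y' - y).
  by apply: seg_int_near_cst => //; exact: cB.
rewrite mulrDr; apply: le_trans (lerD h1 h2); apply: le_trans (ler_normD _ _).
by rewrite le_eqVlt; apply/orP; left; apply/eqP; congr (`|_|); ring.
Qed.

Lemma rect_int_at_point (A D : R -> R -> R) x w y h r0 t0 k e d :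
  0 <= w -> 0 <= h -> x <= r0 <= x + w -> y <= t0 <= y + h ->
  w < d -> h < d -> 0 < e ->
  (forall t, y <= t <= y + h -> {within `[x, x + w], continuous (A ^~ t)}) ->
  (forall r, x <= r <= x + w -> {within `[y, y + h], continuous (D r)}) ->
  (forall r t t', x <= r <= x + w -> `|r - r0| < d -> `|t - t0| < d -> `|t' - t0| < d ->
    `|A r t' - A r t - k * (t' - t)| <= e * (`|r - r0| + `|t - t0| + `|t' - t0|)) ->
  (forall r r' t, x <= r <= x + w -> x <= r' <= x + w ->
    `|r - r0| < d -> `|r' - r0| < d -> `|t - t0| < d ->
    `|D r' t - D r t - k * (r' - r)| <= e * (`|r - r0| + `|r' - r0| + `|t - t0|)) ->
  `|rect_int A D x (x + w) y (y + h)| <= e * (2 * (w + h)) * (w + h).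
Proof.
move=> w0 h0 rr tt wd hd e0 cA cD dA dD.
have inE (u v l z : R) : u <= v <= u + l -> u <= z <= u + l -> `|z - v| <= l.
  by clear=> /andP[? ?] /andP[? ?]; rewrite ler_norml; apply/andP; split; lra.
have ends (u l : R) : 0 <= l -> u <= u <= u + l /\ u <= u + l <= u + l.
  by clear=> l0; rewrite !lexx; split; lra.
have [xx xx'] := ends x w w0; have [yy yy'] := ends y h h0.
have sum3 (u v z : R) : u <= w -> v <= w -> z <= h -> e * (u + v + z) <= e * (2 * (w + h)).
  by move=> uw vw zh; rewrite ler_pM2l//; clear -uw vw zh h0; lra.
have sum3' (u v z : R) : u <= w -> v <= h -> z <= h -> e * (u + v + z) <= e * (2 * (w + h)).
  by move=> uw vw zh; rewrite ler_pM2l//; clear -uw vw zh w0; lra.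
(* The remainder of each increment is at most [e] times three distances to [(r0, t0)], each at most
   [w] or [h]; hence the factor [2 * (w + h)]. *)
have -> : e * (2 * (w + h)) * (w + h) = e * (2 * (w + h)) * ((x + w - x) + (y + h - y)).
  by rewrite !(addrC _ (- _)) !addKr.
apply: (@rect_int_small _ _ _ _ _ _ k); rewrite ?lerDl//;
  [exact: cA|exact: cA|exact: cD|exact: cD| |].
  move=> r rP; have h1 := inE _ _ _ _ rr rP; have h2 := inE _ _ _ _ tt yy.
  have h3 := inE _ _ _ _ tt yy'.
  apply: le_trans (dA _ _ _ rP (le_lt_trans h1 wd) (le_lt_trans h2 hd)
    (le_lt_trans h3 hd)) _.
  exact: sum3'.
move=> t tP; have h1 := inE _ _ _ _ tt tP; have h2 := inE _ _ _ _ rr xx.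
have h3 := inE _ _ _ _ rr xx'.
apply: le_trans (dD _ _ _ xx xx' (le_lt_trans h2 wd) (le_lt_trans h3 wd)
  (le_lt_trans h1 hd)) _.
exact: sum3.
Qed.

(* Only differentiability at each point is assumed, hence Goursat's bisection
   instead of differentiation under the integral sign. *)
Theorem goursat_rectangle (A D : R -> R -> R) a a' b b' :
  a <= a' -> b <= b' ->
  (forall t, b <= t <= b' -> {within `[a, a'], continuous (A ^~ t)}) ->
  (forall r, a <= r <= a' -> {within `[b, b'], continuous (D r)}) ->
  (forall r0 t0, a <= r0 <= a' -> b <= t0 <= b' ->
    exists k : R, forall e : R, 0 < e -> exists2 d : R, 0 < d &
      (forall r t t', a <= r <= a' -> `|r - r0| < d -> `|t - t0| < d -> `|t' - t0| < d ->
        `|A r t' - A r t - k * (t' - t)| <= e * (`|r - r0| + `|t - t0| + `|t' - t0|)) /\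
      (forall r r' t, a <= r <= a' -> a <= r' <= a' ->
        `|r - r0| < d -> `|r' - r0| < d -> `|t - t0| < d ->
        `|D r' t - D r t - k * (r' - r)| <= e * (`|r - r0| + `|r' - r0| + `|t - t0|))) ->
  rect_int A D a a' b b' = 0.
Proof.
move=> aa bb cA cD dAD; apply/eqP/negPn/negP => /eqP I0.
set I := rect_int A D a a' b b' in I0.
pose w : R := a' - a; pose h : R := b' - b.
have w0 : 0 <= w by rewrite /w; lra.
have h0 : 0 <= h by rewrite /h; lra.
have pw n : (0 : R) < 2 ^+ n by rewrite exprn_gt0.
have halfE (v : R) n : v / 2 ^+ n = v / 2 ^+ n.+1 + v / 2 ^+ n.+1.
  by rewrite exprS; field; rewrite gt_eqF.
have v2 (v : R) n : 0 <= v -> 0 <= v / 2 ^+ n by move=> v0; rewrite divr_ge0// ltW.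
(* A bad rectangle lies in the original one and keeps at least the share [1 / 4 ^+ n] of the
   integral; by pigeonhole one of its quarters is bad again. *)
pose Q n x y := [/\ a <= x, x + w / 2 ^+ n <= a', b <= y, y + h / 2 ^+ n <= b' &
  `|I| / 4 ^+ n <= `|rect_int A D x (x + w / 2 ^+ n) y (y + h / 2 ^+ n)|].
have Q0 : Q 0%N a b.
  rewrite /Q !expr0 !divr1 /w /h !lexx !subrKC !lexx; split => //.
have QS n x y : Q n x y -> exists i j : bool,
     Q n.+1 (x + i%:R * (w / 2 ^+ n.+1)) (y + j%:R * (h / 2 ^+ n.+1)).
  move=> [ax xa by_ yb].
  have wn := v2 _ n.+1 w0; have hn := v2 _ n.+1 h0.
  move: xa yb; rewrite /Q (halfE w) (halfE h) !addrA.
  set w' := w / _ in wn *; set h' := h / _ in hn * => xa yb.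
  rewrite (@rect_int_quarters A D a a' b b' x (x + w') _ y (y + h')) //; last 2 first.
    by split; rewrite ?lerDl.
    by split; rewrite ?lerDl.
  set q1 := rect_int _ _ _ _ _ _; set q2 := rect_int _ _ _ _ _ _.
  set q3 := rect_int _ _ _ _ _ _; set q4 := rect_int _ _ _ _ _ _ => qI.
  have {qI} : `|I| / 4 ^+ n <= `|q1| + `|q2| + (`|q3| + `|q4|).
    apply: le_trans qI _; apply: le_trans (ler_normD _ _) _.
    by apply: lerD; exact: ler_normD.
  have -> : `|I| / 4 ^+ n = 4 * (`|I| / 4 ^+ n.+1).
    by rewrite exprS; field; rewrite expf_neq0// pnatr_eq0.
  set J := `|I| / _ => qI.
  have : [\/ J <= `|q1|, J <= `|q2|, J <= `|q3| | J <= `|q4|].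
    have [|h1] := leP J `|q1|; first by constructor.
    have [|h2] := leP J `|q2|; first by constructor.
    have [|h3] := leP J `|q3|; first by constructor.
    have [|h4] := leP J `|q4|; first by constructor.
    by move: qI; rewrite leNgt => /negP[]; clear -h1 h2 h3 h4; lra.
  by case=> qJ; [exists false, false|exists true, false
    |exists false, true|exists true, true];
    rewrite /= ?mul1r ?mul0r ?addr0; split => //;
    by clear -ax xa by_ yb wn hn; lra.
have [r0 [t0 rtP]] := bisect_rectangle _ Q a b w h w0 h0 Q0 QS.
have r0P : a <= r0 <= a'.
  have [x [y [[ax xa _ _ _] xr _]]] := rtP 0%N.
  by move: xa xr; rewrite expr0 divr1 => xa /andP[? ?]; apply/andP; split; lra.
have t0P : b <= t0 <= b'.
  have [x [y [[_ _ bY yb _] _ yt]]] := rtP 0%N.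
  by move: yb yt; rewrite expr0 divr1 => yb /andP[? ?]; apply/andP; split; lra.
have [k kP] := dAD _ _ r0P t0P.
have I1 : 0 < `|I| by rewrite normr_gt0; exact/eqP.
pose s : R := w + h.
have s0 : 0 <= s by rewrite /s; lra.
have s1 : 0 < s ^+ 2 + 1 by rewrite ltr_wpDl// sqr_ge0.
(* At level [n] the local estimate is [2 * e * s ^+ 2 / 4 ^+ n], which this choice makes less than
   half of [|I| / 4 ^+ n]. Adding 1 keeps the denominator positive when [s = 0]. *)
pose e : R := `|I| / (4 * (s ^+ 2 + 1)).
have e0 : 0 < e by rewrite divr_gt0// mulr_gt0.
have [d d0 [dA dD]] := kP e e0.
have [n sn] : exists n, s / 2 ^+ n < d.
  exists (Num.truncn (s / d)).+1; rewrite ltr_pdivrMr// -ltr_pdivrMl// mulrC.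
  apply: lt_trans (truncnS_gt _) _.
  by rewrite -natrX ltr_nat ltn_expl.
have [x [y [[ax xa by_ yb qI] /andP[xr rx] /andP[yt ty]]]] := rtP n.
have wn := v2 _ n w0; have hn := v2 _ n h0.
have sE : s / 2 ^+ n = w / 2 ^+ n + h / 2 ^+ n by rewrite /s mulrDl.
have wd : w / 2 ^+ n < d by apply: le_lt_trans sn; rewrite sE lerDl.
have hd : h / 2 ^+ n < d by apply: le_lt_trans sn; rewrite sE lerDr.
have wa r : x <= r <= x + w / 2 ^+ n -> a <= r <= a'.
  by clear -ax xa => /andP[? ?]; apply/andP; split; lra.
have hb t : y <= t <= y + h / 2 ^+ n -> b <= t <= b'.
  by clear -by_ yb => /andP[? ?]; apply/andP; split; lra.
have : `|I| / 4 ^+ n <= e * (2 * (s / 2 ^+ n)) * (s / 2 ^+ n).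
  apply: le_trans qI _; rewrite sE.
  apply: (@rect_int_at_point _ _ _ _ _ _ r0 t0 k _ d) => //; try exact/andP.
  - by move=> t /hb/cA; exact: within_continuous_sub.
  - by move=> r /wa/cD; exact: within_continuous_sub.
  - by move=> r t t' /wa; exact: dA.
  - by move=> r r' t /wa ? /wa ?; exact: dD.
have -> : e * (2 * (s / 2 ^+ n)) * (s / 2 ^+ n) =
    (`|I| / 4 ^+ n) * (s ^+ 2 / (s ^+ 2 + 1) / 2).
  have -> : (4 : R) ^+ n = 2 ^+ n * 2 ^+ n by rewrite -exprMn; congr (_ ^+ _); ring.
  by rewrite /e; field; rewrite !gt_eqF.
apply/negP; rewrite -ltNge -[ltRHS]mulr1 ltr_pM2l ?divr_gt0 ?exprn_gt0//.
rewrite ltr_pdivrMr// mul1r ltr_pdivrMr//.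
by have := sqr_ge0 s; clear; lra.
Qed.
End Rectangle.

(** * The mean value property *)

Section Polar.
Variable R : realType.
Implicit Types (r t e d : R) (z c : R[i]) (f : R[i] -> R[i]).
Local Notation Re := complex.Re.
Local Notation Im := complex.Im.

Lemma derive1_approx (F : R -> R) (x l : R) : is_derive x 1 F l ->
  forall e : R, 0 < e -> exists2 d : R, 0 < d &
    forall h, `|h| < d -> `|F (x + h) - F x - l * h| <= e * `|h|.
Proof.
move=> [dF lE] e e0; move: dF lE; rewrite /derivable /derive => dF lE.
have : h^-1 *: (F (h *: 1 + x) - F x) @[h --> 0^'] --> l.
  by rewrite -lE; exact: dF.
move=> /cvgrPdist_le/(_ e e0)/nbhs_ballP[d /= d0 dP].
exists d => // h hd; have [->|h0] := eqVneq h 0.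
  by rewrite addr0 subrr mulr0 subrr normr0 mulr0.
have := dP h; rewrite /ball/= sub0r normrN => /(_ hd h0).
rewrite -(ler_pM2r (_ : 0 < `|h|)) ?normr_gt0// -normrM => H; apply: le_trans H.
by rewrite -(normrN (_ * h)) le_eqVlt; apply/orP; left; apply/eqP; congr (`|_|);
  rewrite /GRing.scale/= mulr1 (addrC h x); field.
Qed.

Lemma normc_Re z : `|Re z| <= normc z.
Proof. by rewrite -lecR; exact: normc_ge_Re. Qed.

Lemma normc_i : normc ('i : R[i]) = 1.
Proof. by rewrite /= expr0n/= add0r expr1n sqrtr1. Qed.

Lemma normc_Im z : `|Im z| <= normc z.
Proof.
by have := normc_Re (z * 'i); rewrite ReiNIm normrN normcM normc_i mulr1.
Qed.

Lemma normc_real r : normc r%:C = `|r|.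
Proof. by rewrite /= expr0n/= addr0 sqrtr_sqr. Qed.

Lemma normc_le_sum z : normc z <= `|Re z| + `|Im z|.
Proof.
rewrite {1}[z]complexE.
by apply: le_trans (normc_triangle _ _) _; rewrite normcM normc_i mul1r !normc_real.
Qed.

Definition cis t : R[i] := cos t +i* sin t.

Lemma cisD s t : cis (s + t) = cis s * cis t.
Proof. by rewrite /cis cosD sinD; simpc; rewrite [X in _ +i* X]addrC. Qed.

Lemma normc_cis t : normc (cis t) = 1.
Proof. by rewrite /= cos2Dsin2 sqrtr1. Qed.

Lemma cis_approx e : 0 < e -> exists2 d : R, 0 < d &
  forall h, `|h| < d -> normc (cis h - 1 - 'i * h%:C) <= e * `|h|.
Proof.
move=> e0; have e2 : 0 < e / 2 by rewrite divr_gt0.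
have [d1 d10 h1] := derive1_approx _ _ _ (is_derive_cos 0) _ e2.
have [d2 d20 h2] := derive1_approx _ _ _ (is_derive_sin 0) _ e2.
exists (Num.min d1 d2); first by rewrite lt_min d10.
move=> h; rewrite lt_min => /andP[/h1 + /h2].
rewrite !add0r cos0 sin0 oppr0 mul0r subr0 addr0 mul1r => c1 s1.
apply: le_trans (normc_le_sum _) _; rewrite (splitr e) mulrDl.
have -> : cis h - 1 - 'i * h%:C = (cos h - 1) +i* (sin h - h).
  by rewrite /cis; simpc; congr (_ +i* _); ring.
exact: lerD.
Qed.

Definition polar_pt r t : R[i] := r%:C * cis t.
Local Notation polar := polar_pt.

(** The difference quotient is multiplied out, so that [z = z0] is no exception. *)
Definition cderiv_at f z0 c := forall e : R, 0 < e -> exists2 d : R, 0 < d &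
  forall z, normc (z - z0) < d ->
    normc (f z - f z0 - c * (z - z0)) <= e * normc (z - z0).

(** Chain rule for $f(re^{it})$: since $d(re^{it}) = e^{it}(dr + i r\,dt)$, the differential at
    [(r0, t0)] is [c * cis t0] times $dr + i r_0\,dt$. *)
Lemma polar_approx f r0 t0 c : cderiv_at f (polar r0 t0) c ->
  forall e : R, 0 < e -> exists2 d : R, 0 < d &
    forall r t, `|r - r0| < d -> `|t - t0| < d ->
    normc (f (polar r t) - f (polar r0 t0) -
      c * cis t0 * ((r - r0)%:C + 'i * (r0 * (t - t0))%:C)) <=
    e * (`|r - r0| + `|t - t0|).
Proof.
move=> df e e0.
have cancel (u v x : R) : 0 < u -> u * (v / u * x) = v * x.
  by move=> u0; field; rewrite gt_eqF.
pose N := `|r0| + 1; pose M := normc c + 1.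
have N0 : 0 < N by rewrite ltr_wpDl.
have M0 : 0 < M by rewrite ltr_wpDl ?normc_ge0.
(* The bound 1 makes the polar map Lipschitz with constant [N + 1] near [(r0, t0)]; the bound
   [e / 2 / M] makes the parametrization error, multiplied by [c], cost at most half of [e]. *)
pose eta := Num.min 1 (e / 2 / M).
have eta0 : 0 < eta by rewrite lt_min ltr01 !divr_gt0.
have N1 : 0 < N + 1 by rewrite addr_gt0.
have [d1 d10 fP] := df (e / 2 / (N + 1)) ltac:(by rewrite !divr_gt0).
have [d2 d20 cP] := cis_approx (eta / 2 / N) ltac:(by rewrite !divr_gt0).
exists (Num.min (Num.min 1 (eta / 2)) (Num.min d2 (d1 / (N + 1) / 2))).
  by rewrite !lt_min ltr01 d20 !divr_gt0.
move=> r t; rewrite !lt_min => /andP[/andP[k1 k2] /andP[_ k4]] /andP[_ /andP[/cP h3 h4]].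
set k := r - r0 in k1 k2 k4 *; set h := t - t0 in h3 h4 *.
(* The exact second-order remainder of the parametrization, as [PE] records. *)
set rho := r%:C * (cis h - 1 - 'i * h%:C) + 'i * (k * h)%:C.
have tE : t = t0 + h by rewrite /h; ring.
have rE : r = r0 + k by rewrite /k; ring.
clearbody k h.
have PE : polar r t - polar r0 t0 = cis t0 * (k%:C + 'i * (r0 * h)%:C + rho).
  by rewrite /polar_pt /rho tE cisD rE !rmorphD/= !rmorphM/=; ring.
have rN : `|r| <= N by rewrite rE; apply: le_trans (ler_normD _ _) _; rewrite /N lerD2l ltW.
have rhoP : normc rho <= eta * `|h|.
  apply: le_trans (normc_triangle _ _) _.
  rewrite !normcM normc_i mul1r !normc_real normrM.
  rewrite (splitr eta) mulrDl; apply: lerD; last by rewrite ler_wpM2r// ltW.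
  apply: (@le_trans _ _ (N * (eta / 2 / N * `|h|))); last first.
    by rewrite cancel.
  by rewrite ler_pM// normc_ge0.
set s := `|k| + `|h|.
have hs : `|h| <= s by rewrite lerDr.
have s0 : 0 <= s by rewrite addr_ge0.
have Ps : normc (polar r t - polar r0 t0) <= (N + 1) * s.
  rewrite PE normcM normc_cis mul1r; apply: le_trans (normc_triangle _ _) _.
  rewrite mulrDl mul1r; apply: lerD; last first.
    apply: le_trans rhoP _; apply: le_trans hs.
    by rewrite ler_piMl// /eta ge_min lexx.
  apply: le_trans (normc_triangle _ _) _.
  rewrite normcM normc_i mul1r !normc_real normrM /N /s.
  have := normr_ge0 k; have := normr_ge0 h; have := normr_ge0 r0; clear.
  move=> ? ? ?; rewrite mulrDr !mulrDl !mul1r.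
  have : 0 <= `|r0| * `|k| by rewrite mulr_ge0.
  lra.
have sd : (N + 1) * s < d1.
  rewrite mulrC -ltr_pdivlMr// (splitr (d1 / (N + 1))) /s.
  exact: ltrD.
have {fP} := fP _ (le_lt_trans Ps sd) => fP.
have -> : f (polar r t) - f (polar r0 t0) - c * cis t0 * (k%:C + 'i * (r0 * h)%:C) =
    (f (polar r t) - f (polar r0 t0) - c * (polar r t - polar r0 t0)) + c * cis t0 * rho.
  by rewrite PE; ring.
apply: le_trans (normc_triangle _ _) _; rewrite (splitr e) mulrDl; apply: lerD.
  apply: le_trans fP _; apply: (@le_trans _ _ (e / 2 / (N + 1) * ((N + 1) * s))).
    by rewrite ler_wpM2l// !divr_ge0// ?ltW.
  by rewrite mulrA divfK ?gt_eqF.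
rewrite !normcM normc_cis mulr1; apply: (@le_trans _ _ (M * (e / 2 / M * s))).
  rewrite ler_pM ?normc_ge0 ?lerDl//; apply: le_trans rhoP _.
  by rewrite ler_pM// ?(ltW eta0)// /eta ge_min lexx orbT.
by rewrite cancel.
Qed.

End Polar.

Section MeanValue.
Variable R : realType.
Implicit Types (r t e d : R) (z c : R[i]) (f : R[i] -> R[i]).
Local Notation Re := complex.Re.
Local Notation Im := complex.Im.
Local Notation polar := (polar_pt R).
Local Notation cderiv_at := (cderiv_at R).

Lemma ReB z c : Re (z - c) = Re z - Re c. Proof. by case: z c => [? ?] []. Qed.
Lemma ImB z c : Im (z - c) = Im z - Im c. Proof. by case: z c => [? ?] []. Qed.

Lemma normc_polar r t : normc (polar r t) = `|r|.
Proof. by rewrite /polar_pt normcM normc_cis mulr1 normc_real. Qed.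

Lemma continuous_at_dist (F : R -> R) (x : R) :
  (forall e : R, 0 < e -> exists2 d : R, 0 < d &
    forall y, `|y - x| < d -> `|F y - F x| <= e) ->
  {for x, continuous F}.
Proof.
move=> H; apply/cvgrPdist_le => e e0; have [d d0 dP] := H e e0.
apply/nbhs_ballP; exists d => //= y; rewrite /ball/= distrC => /dP.
by rewrite distrC.
Qed.

Lemma polar_continuous f r0 t0 c : cderiv_at f (polar r0 t0) c ->
  forall e : R, 0 < e -> exists2 d : R, 0 < d &
    forall r t, `|r - r0| < d -> `|t - t0| < d ->
    normc (f (polar r t) - f (polar r0 t0)) <= e.
Proof.
move=> df e e0; have [d d0 dP] := polar_approx _ _ _ _ _ df 1 ltr01.
set N := normc c * (1 + `|r0|) + 2.
have N0 : 0 < N by rewrite ltr_wpDl// mulr_ge0 ?normc_ge0 ?addr_ge0.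
exists (Num.min d (e / N)); first by rewrite lt_min d0 divr_gt0.
move=> r t; rewrite !lt_min => /andP[k1 k2] /andP[h1 h2].
have {dP} := dP _ _ k1 h1; rewrite mul1r => fP.
set k := r - r0 in k1 k2 fP; set h := t - t0 in h1 h2 fP.
set L := c * _ * _ in fP.
have LP : normc L <= normc c * (1 + `|r0|) * (e / N).
  rewrite /L !normcM normc_cis mulr1 -mulrA ler_wpM2l ?normc_ge0//.
  apply: le_trans (normc_triangle _ _) _.
  rewrite normcM normc_i mul1r !normc_real normrM mulrDl mul1r.
  by rewrite lerD// ?ler_wpM2l// ltW.
rewrite -[_ - _ in leLHS](subrK L); apply: le_trans (normc_triangle _ _) _.
have -> : e = 2 * (e / N) + normc c * (1 + `|r0|) * (e / N).
  by rewrite -mulrDl (addrC 2) -/N mulrC divfK ?gt_eqF.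
by rewrite lerD//; apply: le_trans fP _; rewrite mulr_natl mulr2n lerD// ltW.
Qed.

Definition cholo_disc f (rho : R) := forall z, normc z < rho -> exists c, cderiv_at f z c.

Lemma Re_polar_continuous f rho r : cholo_disc f rho -> 0 <= r < rho ->
  continuous (fun t => Re (f (polar r t))).
Proof.
move=> hf /andP[r0 rr] t; have [|c fc] := hf (polar r t).
  by rewrite normc_polar ger0_norm.
apply: continuous_at_dist => e e0.
have [d d0 dP] := polar_continuous _ _ _ _ fc e e0.
exists d => // y yt; rewrite -ReB; apply: le_trans (normc_Re _ _) _.
by apply: dP => //; rewrite subrr normr0.
Qed.

(* [f dz / z] pulls back to [f (dr / r + i dt)]; its imaginary part is the closed
   form [A dr + D dt]. *)
Lemma polar_circles f rho r1 r2 : cholo_disc f rho -> 0 < r1 -> r1 <= r2 -> r2 < rho ->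
  seg_int R 0 (pi *+ 2) (fun t => Re (f (polar r2 t))) =
  seg_int R 0 (pi *+ 2) (fun t => Re (f (polar r1 t))).
Proof.
move=> hf r10 r12 r2r.
pose A r t := Im (f (polar r t)) / r.
pose D r t := Re (f (polar r t)).
have fP r t : r1 <= r <= r2 -> exists c, cderiv_at f (polar r t) c.
  move=> /andP[h1 h2]; apply: hf; rewrite normc_polar ger0_norm.
    exact: le_lt_trans r2r.
  by apply: le_trans h1; exact: ltW.
have cD r : r1 <= r <= r2 -> {within `[0, pi *+ 2], continuous (D r)}.
  move=> /andP[h1 h2]; apply: continuous_subspaceT.
  apply: Re_polar_continuous hf _; rewrite (le_lt_trans h2 r2r) andbT.
  by apply: le_trans h1; exact: ltW.
have cA t : 0 <= t <= pi *+ 2 -> {within `[r1, r2], continuous (A ^~ t)}.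
  move=> _; apply: continuous_in_subspaceT => r; rewrite inE/= in_itv/= => rP.
  have [c fc] := fP r t rP.
  have r0 : r != 0 by rewrite gt_eqF//; case/andP: rP => + _; exact: lt_le_trans.
  apply: (@continuousM R R (fun r => Im (f (polar r t))) (fun r => r^-1)); last first.
    by apply: continuousV => //; exact: cvg_id.
  apply: continuous_at_dist => e e0.
  have [d d0 dP] := polar_continuous _ _ _ _ fc e e0.
  exists d => // y yt; rewrite -ImB; apply: le_trans (normc_Im _ _) _.
  by apply: dP => //; rewrite subrr normr0.
have : rect_int R A D r1 r2 0 (pi *+ 2) = 0.
  apply: goursat_rectangle => //; first by rewrite mulrn_wge0// pi_ge0.
  move=> r0 t0 r0P t0P; have [c fc] := fP r0 t0 r0P.
  (* Cauchy-Riemann in polar form: the derivative of [A] in [t] and that of [D] in [r] are both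
     [Re (c * cis R t0)]. *)
  set p := Re (c * cis R t0); exists p => e e0.
  (* The minimum absorbs the division by [r] in [A], and the 3 pays for the three error terms in its
     increment. *)
  pose e1 := e * Num.min r1 1 / 3.
  have e10 : 0 < e1 by rewrite divr_gt0// mulr_gt0// lt_min r10 ltr01.
  have [d1 d10 dP] := polar_approx _ _ _ _ _ fc e1 e10.
  have p0 : 0 < `|p| + 1 by rewrite ltr_wpDl.
  (* The second bound controls [p * (r - r0) * (t' - t)], which appears because [A] divides by [r]
     while the differential carries the factor [r0]. *)
  exists (Num.min d1 (e1 / (`|p| + 1))); first by rewrite lt_min d10 divr_gt0.
  pose E r t := f (polar r t) - f (polar r0 t0) -
    c * cis R t0 * ((r - r0)%:C + 'i * (r0 * (t - t0))%:C).
  have EP r t : Re (E r t) = Re (f (polar r t)) - Re (f (polar r0 t0)) -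
        (p * (r - r0) - Im (c * cis R t0) * (r0 * (t - t0))) /\
      Im (E r t) = Im (f (polar r t)) - Im (f (polar r0 t0)) -
        (Im (c * cis R t0) * (r - r0) + p * (r0 * (t - t0))).
    rewrite /E /p !ReB !ImB; case: (c * cis R t0) => u v; simpc => /=.
    by split; ring.
  have E1 r t : `|r - r0| < d1 -> `|t - t0| < d1 ->
      normc (E r t) <= e1 * (`|r - r0| + `|t - t0|) by exact: dP.
  clearbody E.
  split.
    move=> r t t' rP; rewrite !lt_min => /andP[k1 k2] /andP[h1 _] /andP[h1' _].
    have r_gt0 : 0 < r by case/andP: rP => + _; exact: lt_le_trans.
    have -> : A r t' - A r t - p * (t' - t) =
      (Im (E r t') - Im (E r t) - p * (r - r0) * (t' - t)) / r.
      by rewrite !(EP _ _).2 /A; field; rewrite gt_eqF.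
    have e1E : e1 * 3 <= e * r.
      rewrite divfK ?pnatr_eq0// ler_pM2l// ge_min; apply/orP; left.
      by case/andP: rP.
    rewrite normrM normfV (gtr0_norm r_gt0) ler_pdivrMr//.
    have pk : `|p * (r - r0) * (t' - t)| <= e1 * (`|t - t0| + `|t' - t0|).
      rewrite normrM; apply: ler_pM => //.
        rewrite normrM; apply: (@le_trans _ _ ((`|p| + 1) * `|r - r0|)).
          by rewrite ler_wpM2r// lerDl.
        by rewrite mulrC -ler_pdivlMr// ltW.
      have -> : t' - t = (t' - t0) - (t - t0) by ring.
      by rewrite [leRHS]addrC; exact: ler_normB.
    apply: le_trans (ler_normB _ _) _; apply: le_trans (lerD (ler_normB _ _) pk) _.
    have i1 := le_trans (normc_Im _ _) (E1 _ _ k1 h1).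
    have i2 := le_trans (normc_Im _ _) (E1 _ _ k1 h1').
    apply: le_trans (lerD (lerD i2 i1) (lexx _)) _.
    rewrite -mulrDr -mulrDr [leRHS]mulrAC; set S := (X in _ <= _ * X).
    have S0 : 0 <= S by rewrite !addr_ge0.
    apply: (@le_trans _ _ (e1 * 3 * S)); last by rewrite ler_wpM2r.
    rewrite /S -mulrA ler_pM2l//.
    have := normr_ge0 (r - r0); have := normr_ge0 (t - t0); have := normr_ge0 (t' - t0).
    by clear; lra.
  move=> r r' t rP r'P; rewrite !lt_min => /andP[k1 _] /andP[k1' _] /andP[h1 _].
  have -> : D r' t - D r t - p * (r' - r) = Re (E r' t) - Re (E r t).
    by rewrite !(EP _ _).1 /D; ring.
  have e1E : e1 * 2 <= e.
    rewrite /e1 -!mulrA ler_piMr ?(ltW e0)//.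
    have : Num.min r1 1 <= 1 by rewrite ge_min lexx orbT.
    by clear; lra.
  have i1 := le_trans (normc_Re _ _) (E1 _ _ k1 h1).
  have i2 := le_trans (normc_Re _ _) (E1 _ _ k1' h1).
  apply: le_trans (ler_normB _ _) _; apply: le_trans (lerD i2 i1) _.
  rewrite -mulrDr; set S := (X in _ <= _ * X).
  have S0 : 0 <= S by rewrite !addr_ge0.
  apply: (@le_trans _ _ (e1 * 2 * S)); last by rewrite ler_wpM2r.
  rewrite /S -mulrA ler_pM2l//.
  have := normr_ge0 (r - r0); have := normr_ge0 (r' - r0); have := normr_ge0 (t - t0).
  by clear; lra.
rewrite /rect_int.
(* By periodicity the two sides of the slit agree and cancel, leaving the two circles. *)
have -> : seg_int R r1 r2 (A^~ 0) = seg_int R r1 r2 (A^~ (pi *+ 2)).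
  by rewrite /A /polar_pt /cis cos0 sin0 cos2pi sin2pi.
by rewrite subrr add0r => /eqP; rewrite subr_eq0 => /eqP.
Qed.

(** The integral does not depend on the radius, by [polar_circles]. On a circle of small radius [s]
    the integrand differs from [Re (f 0)] by at most [e / (pi *+ 2)]. *)
Theorem mean_value f rho r : cholo_disc f rho -> 0 < r -> r < rho ->
  seg_int R 0 (pi *+ 2) (fun t => Re (f (polar r t))) = pi *+ 2 * Re (f 0).
Proof.
move=> hf r0 rr.
have [c fc] : exists c, cderiv_at f (polar 0 0) c.
  by apply: hf; rewrite normc_polar normr0 (lt_trans r0).
have P0 t : polar 0 t = 0 by rewrite /polar_pt mul0r.
have pp : 0 < pi *+ 2 :> R by rewrite mulrn_wgt0// pi_gt0.
apply/eqP; rewrite -subr_eq0 -normr_le0; apply/ler_addgt0Pr => e e0; rewrite add0r.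
have [d d0 dP] := fc 1 ltr01.
set N := normc c + 1.
have N0 : 0 < N by rewrite ltr_wpDl ?normc_ge0.
pose s := Num.min r (Num.min (d / 2) (e / (pi *+ 2) / N)).
have s0 : 0 < s by rewrite !lt_min r0 !divr_gt0.
have sr : s <= r by rewrite ge_min lexx.
rewrite (polar_circles f rho s r)//. rewrite mulrC -[pi *+ 2 in X in _ - X]subr0.
have -> : e = e / (pi *+ 2) * (pi *+ 2 - 0) by rewrite subr0 divfK ?gt_eqF.
apply: seg_int_near_cst; first exact: ltW.
  apply: continuous_subspaceT; apply: Re_polar_continuous hf _.
  by rewrite ltW//= (le_lt_trans sr).
move=> t _; rewrite -ReB; apply: le_trans (normc_Re _ _) _.
have := dP (polar s t); rewrite P0 subr0 normc_polar gtr0_norm// mul1r.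
have sd : s < d by rewrite (@le_lt_trans _ _ (d / 2))// ?ge_min ?lexx ?orbT//;
   rewrite ltr_pdivrMr// ltr_pMr// ltr1n.
move=> /(_ sd) H; rewrite -[_ - _](subrK (c * polar s t)).
apply: le_trans (normc_triangle _ _) _; rewrite normcM normc_polar gtr0_norm//.
apply: le_trans (lerD H (lexx _)) _.
rewrite -{1}[s]mul1r -mulrDl (addrC 1) -/N -ler_pdivlMl// mulrC.
by rewrite !ge_min lexx !orbT.
Qed.

End MeanValue.

(** * Maximum principles on the unit ball *)

Section Ball.
Variable R : realType.
Implicit Types (r t : R) (z c : R[i]) (x y d : ell2 R).
Local Notation Re := complex.Re.
Local Notation Im := complex.Im.
Local Notation polar := (polar_pt R).
Local Notation nrm := (@ell2_norm R).

Lemma pos_complexP (e : R[i]) : 0 < e -> exists2 r : R, 0 < r & e = r%:C.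
Proof.
move=> e0; exists (Re e); first by move: e0; rewrite ltcE => /andP[].
by rewrite RRe_real// gtr0_real.
Qed.

Lemma ell2_norm_lt x r : (`|x| < r%:C) = (nrm x < r).
Proof. by rewrite ell2_normCE ltcR. Qed.

Lemma ell2_norm0 : nrm 0 = 0.
Proof. by rewrite -(scale0r 0) ell2_normZ normc0 mul0r. Qed.

Lemma ball_norm (x : unit_ball R) : nrm (val x) < 1.
Proof. by rewrite -ell2_norm_lt; case: x. Qed.

Lemma mk_ball x : nrm x < 1 -> {w : unit_ball R | val w = x}.
Proof. by rewrite -ell2_norm_lt => x1; exists (in_ball x1). Qed.

(** The differential is linear over the complex numbers, so its value at [d] is the complex
    derivative of the slice. Later [nrm d + 1] replaces [nrm d] as a divisor because [d] may
    vanish. *)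
Lemma cholo_slice (h : unit_ball R -> R[i]) x d (rho : R) : holomorphic h ->
  (forall z, normc z < rho -> nrm (x + z *: d) < 1) ->
  cholo_disc R (fun z => zero_ext h (x + z *: d)) rho.
Proof.
move=> hh hd z0 z0r; have [w wE] := mk_ball _ (hd z0 z0r).
have := hh w; rewrite wE; set F := zero_ext h; set y := x + z0 *: d => Fd.
pose L := 'd F y; exists (L d) => e e0.
have /diff_locallyP[_ dfo] := Fd.
have N0 : 0 < nrm d + 1 by rewrite ltr_wpDl ?ell2_norm_ge0.
have e1 : 0 < (e / (nrm d + 1))%:C by rewrite ltcR divr_gt0.
have /eqaddoP/(_ _ e1)/nbhs_ballP[_ /= /pos_complexP[q q0 ->] qP] := dfo.
exists (q / (nrm d + 1)); first by rewrite divr_gt0.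
move=> z zz; set v := (z - z0) *: d.
have vn : nrm v <= normc (z - z0) * (nrm d + 1).
  by rewrite ell2_normZ ler_wpM2l ?normc_ge0 ?lerDl.
have vq : ball (0 : ell2 R) (q%:C) v.
  rewrite -ball_normE/= sub0r normrN ell2_norm_lt; apply: le_lt_trans vn _.
  by rewrite -ltr_pdivlMr.
have := qP _ vq.
rewrite -[X in `|X| <= _]/(F (v + y) - (F y + L v)).
have -> : v + y = x + z *: d by rewrite /v /y addrC -addrA -scalerDl subrKC.
have -> : L v = L d * (z - z0) by rewrite /v linearZ/= mulrC.
rewrite opprD addrA normcE_real ell2_normCE -rmorphM lecR => H.
apply: le_trans H _; rewrite mulrAC ler_pdivrMr// -mulrA ler_pM2l//.
Qed.

Lemma Re_max_circle (f : R[i] -> R[i]) (rho r c : R) : cholo_disc R f rho ->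
  0 < r -> r < rho -> (forall t, 0 <= t <= pi *+ 2 -> Re (f (polar r t)) <= c) ->
  Re (f 0) <= c.
Proof.
move=> hf r0 rr fc.
have pp : 0 < pi *+ 2 :> R by rewrite mulrn_wgt0// pi_gt0.
have cf : continuous (fun t => Re (f (polar r t))).
  by apply: Re_polar_continuous hf _; rewrite ltW.
rewrite -(ler_pM2l pp) -(mean_value R f rho r)// (mulrC _ c).
rewrite -{2}[pi *+ 2]subr0 -seg_int_cst; last exact: ltW.
apply: le_seg_int => //; first exact: continuous_subspaceT.
exact: within_continuous_cst.
Qed.

Lemma sqr_normcE z : normc z ^+ 2 = Re z ^+ 2 + Im z ^+ 2.
Proof. by case: z => a b /=; rewrite sqr_sqrtr// addr_ge0// sqr_ge0. Qed.

(** The witness is the unit vector $(\bar v, -\bar u)/\|(u,v)\|$ orthogonal to [(u, v)] in the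
    complex plane $\mathbb C^2$; any unit vector serves at the origin. *)
Lemma unit_orthogonal (u v : R[i]) : exists a b : R[i],
  forall z, normc (u + z * a) ^+ 2 + normc (v + z * b) ^+ 2 =
            normc u ^+ 2 + normc v ^+ 2 + normc z ^+ 2.
Proof.
pose N := normc u ^+ 2 + normc v ^+ 2.
have N0 : 0 <= N by rewrite addr_ge0// sqr_ge0.
have [NE|N1] := eqVneq N 0.
  exists 1, 0 => z; have [] : normc u = 0 /\ normc v = 0.
    split; apply/eqP; rewrite -sqrf_eq0 -normr_le0 ger0_norm ?sqr_ge0// -NE /N.
      by rewrite lerDl sqr_ge0.
    by rewrite lerDr sqr_ge0.
  move=> /eq0_normc -> /eq0_normc ->.
  by rewrite mulr1 mulr0 !add0r normc0 expr0n/= !addr0 add0r.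
have Np : 0 < N by rewrite lt_def N1.
pose s := (Num.sqrt N)^-1.
have s2 : s ^+ 2 * N = 1 by rewrite exprVn sqr_sqrtr// mulVf.
exists (s%:C * v^*), (- (s%:C * u^*)) => z.
move: s2; rewrite /N !sqr_normcE.
clearbody s; clear N N0 N1 Np; case: u v z => [u1 u2] [v1 v2] [z1 z2]; simpc => /= s2.
rewrite -[z1 ^+ 2 + z2 ^+ 2]mulr1 -s2; ring.
Qed.

(** Two coordinates are enough room: the direction is supported on indices 0 and 1, so all partial
    sums with at least two terms change by exactly [normc z ^+ 2]. *)
Lemma orthogonal_direction x : exists d, forall z,
  nrm (x + z *: d) ^+ 2 = nrm x ^+ 2 + normc z ^+ 2.
Proof.
have [a [b abP]] := unit_orthogonal (x 0%N) (x 1%N).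
exists (a *: canonical_vec R 0 + b *: canonical_vec R 1) => z.
set d : ell2 R := a *: canonical_vec R 0 + b *: canonical_vec R 1.
have dE k : d k = a * (k == 0%N)%:R + b * (k == 1%N)%:R by [].
rewrite !ell2_normE.
have E : \forall n \near \oo,
    series (sqmod (x + z *: d)) n = series (sqmod x) n + normc z ^+ 2.
  exists 2%N => // -[//|[//|n]] _.
  rewrite -[LHS]/(\sum_(0 <= k < n.+2) sqmod (x + z *: d) k).
  rewrite -[series _ _]/(\sum_(0 <= k < n.+2) sqmod x k) !big_nat_recl//.
  have -> : \sum_(0 <= i < n) sqmod (x + z *: d) i.+2 = \sum_(0 <= i < n) sqmod x i.+2.
    apply: eq_bigr => i _; rewrite /sqmod; congr (normc _ ^+ 2).
    by rewrite -[LHS]/(x i.+2 + z * d i.+2) dE !mulr0 addr0 mulr0 addr0.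
  have sE k : sqmod (x + z *: d) k = normc (x k + z * d k) ^+ 2 by [].
  rewrite !sE !dE/= !mulr1 !mulr0 addr0 add0r.
  by have := abP z; rewrite /sqmod; clear; lra.
have cx := @ell2_cvg R x.
apply: cvg_lim => //.
apply: (@cvg_trans _ ((series (sqmod x) \+ cst (normc z ^+ 2)) @ \oo)).
  by apply: near_eq_cvg; apply: filterS E => n ->.
by apply: cvgD => //; exact: cvg_cst.
Unshelve. all: by end_near. Qed.

End Ball.

Section MaxPrinciple.
Variable R : realType.
Implicit Types (r t : R) (z c : R[i]) (y d : ell2 R) (x w : unit_ball R).
Local Notation Re := complex.Re.
Local Notation polar := (polar_pt R).
Local Notation nrm := (@ell2_norm R).

Lemma polar_cts r0 t0 (e : R) : 0 < e -> exists2 d : R, 0 < d &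
  forall r t, `|r - r0| < d -> `|t - t0| < d -> normc (polar r t - polar r0 t0) <= e.
Proof.
have id1 : cderiv_at R id (polar r0 t0) 1.
  move=> e' e'0; exists 1 => // z _.
  by rewrite mul1r subrr normc0 mulr_ge0 ?normc_ge0 ?ltW.
exact: polar_continuous id1 e.
Qed.

Lemma rotate_real z : exists2 u : R[i], normc u = 1 & u * z = (normc z)%:C.
Proof.
have [->|z0] := eqVneq z 0; first by exists 1; rewrite ?normc1 ?mulr0 ?normc0.
have n0 : normc z != 0 by apply: contra_neq z0; exact: eq0_normc.
exists ((normc z)%:C / z); last by rewrite divfK.
by rewrite normcM normcV normc_real ger0_norm ?normc_ge0// divff.
Qed.

Lemma holomorphic_scale (V : normedModType R[i]) (u : R[i]) (h : unit_ball R -> V) :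
  holomorphic h -> holomorphic (fun x => u *: h x).
Proof.
move=> hh; have -> : (fun x => u *: h x) = u *: h + (fun=> 0).
  by apply/funext => x; rewrite -[RHS]/(u *: h x + 0) addr0.
by apply: holomorphic_lin => //; exact: holomorphic_cst.
Qed.

(* The disc [x + z d], [d] orthogonal to [x], has its boundary circle on the unit
   sphere, so compactness of that circle makes the boundary bound uniform. *)
Theorem ball_max_principle (h : unit_ball R -> R[i]) (c : R) : holomorphic h ->
  (forall y, nrm y = 1 -> forall e : R, 0 < e -> exists2 d : R, 0 < d &
    forall w : unit_ball R, nrm (val w - y) < d -> normc (h w) <= c + e) ->
  forall x, normc (h x) <= c.
Proof.
move=> hh hc x; apply/ler_addgt0Pr => e e0.
have [d dP] := orthogonal_direction R (val x).
have nx := ball_norm R x.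
have nx0 := @ell2_norm_ge0 R (val x).
pose rho := Num.sqrt (1 - nrm (val x) ^+ 2).
have x2 : nrm (val x) ^+ 2 < 1 by rewrite expr_lt1.
have rho0 : 0 < rho by rewrite sqrtr_gt0 subr_gt0.
have rho2 : rho ^+ 2 = 1 - nrm (val x) ^+ 2 by rewrite sqr_sqrtr// subr_ge0 ltW.
have inb z : normc z < rho -> nrm (val x + z *: d) < 1.
  move=> zr; rewrite -(@expr_lt1 _ 2)// ?ell2_norm_ge0// dP.
  rewrite -ltrBrDl -rho2 ltr_pXn2r// ?nnegrE ?normc_ge0 ?ltW//.
(* A unimodular factor makes the value at the centre real and nonnegative, so bounding the real part
   bounds the modulus. *)
have [u u1 uE] := rotate_real (h x).
pose k w := u *: h w.
have hk : holomorphic k by exact: holomorphic_scale.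
pose f z := zero_ext k (val x + z *: d).
have hf : cholo_disc R f rho by exact: cholo_slice.
have f0 : Re (f 0) = normc (h x).
  by rewrite /f scale0r addr0 zero_extE /k /GRing.scale/= uE.
rewrite -f0.
(* The circle of radius [rho] itself is out of reach, as [h] lives on the open ball. A covering of
   the angles gives one smaller radius that works for all of them. *)
suff : \forall r \near rho^'-,
    forall t, [set` `[0, pi *+ 2]] t -> Re (f (polar r t)) <= c + e.
  move=> H; near rho^'- => r; apply: (Re_max_circle _ _ rho r) => //.
  by near: r; apply: filterS H => r H t tP; apply: H; rewrite /= in_itv.
have /compact_near_coveringP cov := @segment_compact R 0 (pi *+ 2).
apply: cov => t _ /=.
pose y := val x + polar rho t *: d.
have y1 : nrm y = 1.
  apply/eqP; rewrite -(@eqrXn2 _ 2) ?ell2_norm_ge0// expr1n dP normc_polar.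
  by rewrite gtr0_norm// rho2 subrKC.
have [q q0 qP] := hc y y1 e e0.
have N0 : 0 < nrm d + 1 by rewrite ltr_wpDl ?ell2_norm_ge0.
have [s s0 sP] := polar_cts rho t (q / (nrm d + 1) / 2) ltac:(by rewrite !divr_gt0).
exists (ball t s, [set r | `|r - rho| < s /\ 0 < r < rho]).
  split; first exact: nbhsx_ballx.
  near=> r; split; [near: r|apply/andP; split; near: r].
  - exists s => //= r'; rewrite /ball/= distrC; exact.
  - exact: nbhs_left_gt.
  - exact: nbhs_left_lt.
move=> [t' r] /= [t't [rs /andP[r0 rr]]].
have pr : normc (polar r t') < rho by rewrite normc_polar gtr0_norm.
have [w wE] := mk_ball R _ (inb _ pr).
rewrite /f -wE zero_extE /k; apply: le_trans (ler_norm _) _.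
apply: le_trans (normc_Re _ _) _; rewrite /GRing.scale/= normcM u1 mul1r.
apply: qP; rewrite wE /y opprD addrACA subrr add0r -scalerBl ell2_normZ.
have t'd : `|t' - t| < s by rewrite distrC.
apply: (@le_lt_trans _ _ (q / (nrm d + 1) / 2 * (nrm d + 1))).
  by apply: ler_pM; rewrite ?normc_ge0 ?ell2_norm_ge0 ?lerDl//; exact: sP.
by rewrite mulrAC divfK ?gt_eqF// ltr_pdivrMr// ltr_pMr// ltr1n.
Unshelve. all: by end_near. Qed.

Lemma seg_int_pos (q : R -> R) (b t0 : R) : 0 < b -> 0 <= t0 <= b -> continuous q ->
  (forall t, 0 <= q t) -> 0 < q t0 -> 0 < seg_int R 0 b q.
Proof.
move=> b0 t0b cq q0 qt0.
have q2 : 0 < q t0 / 2 by rewrite divr_gt0.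
have := cq t0 => /cvgrPdist_lt/(_ _ q2)/nbhs_ballP[d /= d0 dP].
(* The interval where [q] stays above [q t0 / 2] is clipped, because [t0] may be an endpoint. *)
pose l := Num.max 0 (t0 - d / 2); pose u := Num.min b (t0 + d / 2).
have cs a' b' : {within `[a', b'], continuous q} by exact: continuous_subspaceT.
have l0 : 0 <= l by rewrite le_max lexx.
have ub : u <= b by rewrite ge_min lexx.
have d2 : 0 < d / 2 by rewrite divr_gt0.
have lu : l < u.
  move: t0b => /andP[h1 h2]; rewrite lt_min !gt_max b0 /=.
  apply/andP; split; [|apply/andP; split].
  - by clear -h2 d2; lra.
  - by clear -h1 d2; lra.
  - by clear -d2; lra.
rewrite (@seg_int_split R 0 b l q)// ?(le_trans (ltW lu))//.
rewrite (@seg_int_split R l b u q)// ?(ltW lu)//.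
have pos a' b' : 0 <= seg_int R a' b' q by apply: Rintegral_ge0 => t _; exact: q0.
apply: ltr_wpDl => //; apply: ltr_pwDl => //.
apply: (@lt_le_trans _ _ (seg_int R l u (cst (q t0 / 2)))).
  by rewrite seg_int_cst ?(ltW lu)// mulr_gt0// subr_gt0.
apply: le_seg_int => //; first exact: within_continuous_cst.
move=> t /andP[ht tu].
have : ball t0 d t.
  rewrite /ball/= ltr_norml; move: ht tu; rewrite ge_max le_min.
  move=> /andP[_ h1] /andP[_ h2]; clear -h1 h2 d0; apply/andP; split; lra.
move=> /dP; rewrite ltr_norml => /andP[_]; rewrite /cst; clear; lra.
Qed.

Definition rcontinuous (u : unit_ball R -> R) := forall x (e : R), 0 < e ->
  exists2 d : R, 0 < d & forall w, nrm (val w - val x) < d -> `|u w - u x| < e.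

Lemma local_strong_max (u : unit_ball R -> R) x : rcontinuous u ->
  (forall w, 0 <= u w) ->
  (forall e : R, 0 < e -> exists2 h : unit_ball R -> R[i], holomorphic h &
    (forall w, u w <= Re (h w)) /\ Re (h x) <= e) ->
  forall w, nrm (val w - val x) < 1 - nrm (val x) -> u w = 0.
Proof.
move=> cu u0 uh w; set d := val w - val x => wx.
apply/eqP; rewrite eq_le u0 andbT leNgt; apply/negP => uw.
have nd := @ell2_norm_ge0 R d.
have D1 : 0 < nrm d + 1 by rewrite ltr_wpDl.
(* A radius above 1 with [rho * nrm d <= 1 - nrm (val x)]: the closed unit disc of parameters then
   stays inside the ball, also when [d = 0]. *)
pose rho := 1 + (1 - nrm (val x) - nrm d) / (nrm d + 1).
have rho1 : 1 < rho by rewrite ltrDl divr_gt0// subr_gt0.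
have rhod : rho * nrm d <= 1 - nrm (val x).
  rewrite mulrDl mul1r -lerBrDl mulrAC ler_pdivrMr// ler_wpM2l ?lerDl//.
  by rewrite subr_ge0 ltW.
have inb z : normc z < rho -> nrm (val x + z *: d) < 1.
  move=> zr; apply: le_lt_trans (ell2_normD _ _) _; rewrite ell2_normZ -ltrBrDl.
  have [->|d0] := eqVneq (nrm d) 0; first by rewrite mulr0 subr_gt0 ball_norm.
  by apply: lt_le_trans rhod; rewrite ltr_pM2r// lt_def d0.
have inc t : {v : unit_ball R | val v = val x + polar 1 t *: d}.
  by apply: mk_ball; apply: inb; rewrite normc_polar normr1.
pose q t := u (sval (inc t)).
have q0 t : 0 <= q t by exact: u0.
have qw : 0 < q 0.
  suff wE : sval (inc 0) = w by rewrite /q wE.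
  by apply/val_inj; rewrite (svalP (inc 0)) /polar_pt /cis cos0 sin0 mulr1 scale1r
    /d subrKC.
have cq : continuous q.
  move=> t; apply: continuous_at_dist => e e0.
  have [s s0 sP] := cu (sval (inc t)) e e0.
  have [s1 s10 s1P] := polar_cts 1 t (s / 2 / (nrm d + 1)) ltac:(by rewrite !divr_gt0).
  exists s1 => // t' tt'; apply/ltW/sP; rewrite (svalP (inc t)) (svalP (inc t')).
  rewrite opprD addrACA subrr add0r -scalerBl ell2_normZ.
  apply: (@le_lt_trans _ _ (s / 2 / (nrm d + 1) * (nrm d + 1))).
    by apply: ler_pM; rewrite ?normc_ge0 ?lerDl//; apply: s1P; rewrite ?subrr ?normr0.
  by rewrite divfK ?gt_eqF// ltr_pdivrMr// ltr_pMr// ltr1n.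
have pp : 0 < pi *+ 2 :> R by rewrite mulrn_wgt0// pi_gt0.
have I0 : 0 < seg_int R 0 (pi *+ 2) q.
  by apply: (seg_int_pos _ _ 0) => //; rewrite lexx ltW.
set I := seg_int _ _ _ _ in I0.
(* Half of the mean of [u] on the circle, so that the majorant has too small a mean. *)
have [h hh [uh1 hx]] := uh (I / (pi *+ 2) / 2) ltac:(by rewrite !divr_gt0).
pose f z := zero_ext h (val x + z *: d).
have hf : cholo_disc R f rho by exact: cholo_slice.
have : I <= pi *+ 2 * Re (f 0).
  rewrite -(mean_value R f rho 1)//; apply: le_seg_int.
  - exact: continuous_subspaceT.
  - by apply: continuous_subspaceT; apply: Re_polar_continuous hf _; rewrite ler01.
  - by move=> t _; rewrite /f -(svalP (inc t)) zero_extE; exact: uh1.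
rewrite /f scale0r addr0 zero_extE -ler_pdivrMl// mulrC => H.
have := le_trans H hx; rewrite leNgt => /negP; apply.
by rewrite ltr_pdivrMr// ltr_pMr ?divr_gt0// ltr1n.
Qed.

(** Walk from [x] to 0 along the radius; the largest ball around 0 is then the whole unit ball.
    Steps of length at most [N%:R^-1 < 1 - nrm (val x)] are admissible, as the distance to the
    sphere grows on the way. *)
Lemma ball_chain (Z : unit_ball R -> Prop) : (exists x, Z x) ->
  (forall x, Z x -> forall w, nrm (val w - val x) < 1 - nrm (val x) -> Z w) ->
  forall w, Z w.
Proof.
move=> [x Zx] ZS.
have [v0 v0E] : {w : unit_ball R | val w = 0} by apply: mk_ball; rewrite ell2_norm0.
suff Zo : Z v0 by move=> w; apply: (ZS v0) => //; rewrite v0E ell2_norm0 !subr0; exact: ball_norm.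
have nx := ball_norm R x; have nx0 := @ell2_norm_ge0 R (val x).
pose N := (Num.truncn (1 - nrm (val x))^-1).+1.
have NP : N%:R^-1 < 1 - nrm (val x).
  by rewrite invf_plt ?posrE ?ltr0n ?subr_gt0// truncnS_gt.
have N0 : (0 : R) < N%:R by rewrite ltr0n.
pose s k : R := 1 - k%:R / N%:R.
have s01 k : (k <= N)%N -> 0 <= s k <= 1.
  move=> kN; rewrite /s subr_ge0 ler_pdivrMr// mul1r ler_nat kN/=.
  by rewrite gerBl divr_ge0.
have sb k : (k <= N)%N -> nrm ((s k)%:C *: val x) <= nrm (val x).
  move=> /s01/andP[s0 s1]; rewrite ell2_normZ normc_real ger0_norm//.
  by rewrite ler_piMl.
have H k : (k <= N)%N -> forall w, val w = (s k)%:C *: val x -> Z w.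
  elim: k => [_ w|k IH kN w wE].
    by rewrite /s mul0r subr0 scale1r => /val_inj ->.
  have [v vE] := mk_ball R _ (le_lt_trans (sb _ (ltnW kN)) nx).
  apply: (ZS v); first exact: IH (ltnW kN) _ vE.
  rewrite wE vE -scalerBl -rmorphB.
  have -> : s k.+1 - s k = - N%:R^-1 by rewrite /s -natr1; field; rewrite gt_eqF.
  apply: (@le_lt_trans _ _ N%:R^-1).
    rewrite ell2_normZ normc_real normrN gtr0_norm ?invr_gt0//.
    by rewrite ler_piMr ?invr_ge0 ?ltW.
  by apply: lt_le_trans NP _; rewrite lerD2l lerN2 sb// ltnW.
apply: (H N (leqnn N)); rewrite v0E /s divff ?gt_eqF// subrr.
by rewrite scale0r.
Qed.

End MaxPrinciple.

(** * Boundary values and truncated inner products *)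

Section Functionals.
Variable R : realType.
Implicit Types (r t : R) (z c : R[i]) (y a b : ell2 R) (x w : unit_ball R).
Local Notation Re := complex.Re.
Local Notation nrm := (@ell2_norm R).

(* Truncated inner products: finite sums suffice because [N] can be taken large
   once all the other parameters are fixed. *)
Definition fdot (N : nat) a y : R[i] := \sum_(k < N) (a k)^* * y k.

Lemma differentiable_coord n y : differentiable (fun y : ell2 R => y n : R[i]) y.
Proof.
pose c (y : ell2 R) : R[i] := y n.
have clin : linear c by [].
pose C : {linear ell2 R -> R[i]} :=
  HB.pack c (GRing.isLinear.Build R[i] (ell2 R) R[i] *:%R c clin).
have Ccont : continuous C.
  apply: bounded_linear_continuous; apply/bounded_funP => r; exists r => x.
  by apply: le_trans; rewrite normcE_real ell2_normCE lecR normc_le_ell2_norm.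
exact: (@linear_differentiable _ _ _ C).
Qed.

Lemma holomorphic_coord_comp (g : unit_ball R -> ell2 R) n : holomorphic g ->
  holomorphic (fun w => g w n : R[i]).
Proof.
move=> hg.
apply: (holomorphicP (F := (fun y : ell2 R => y n : R[i]) \o zero_ext g)) => x.
  by rewrite /= zero_extE.
apply: differentiable_comp; first exact: hg.
exact: differentiable_coord.
Qed.

Lemma holomorphic_fdot (g : unit_ball R -> ell2 R) N a : holomorphic g ->
  holomorphic (fun w => fdot N a (g w) : R[i]).
Proof.
move=> hg; elim: N => [|N IH].
  have -> : (fun w => fdot 0 a (g w)) = (fun=> 0).
    by apply/funext => w; rewrite /fdot big_ord0.
  exact: holomorphic_cst.
have -> : (fun w => fdot N.+1 a (g w)) =
    (a N)^* *: (fun w => g w N : R[i]) + (fun w => fdot N a (g w)).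
  by apply/funext => w; rewrite /fdot big_ord_recr addrC.
by apply: holomorphic_lin => //; exact: holomorphic_coord_comp.
Qed.

Lemma partial_le y N : \sum_(k < N) normc (y k) ^+ 2 <= nrm y ^+ 2.
Proof.
rewrite ell2_normE; apply: le_trans (series_sqmod_le y N).
by rewrite /series/= big_mkord.
Qed.

Lemma norm_le_partial y (m : R) : (forall N, \sum_(k < N) normc (y k) ^+ 2 <= m) ->
  nrm y ^+ 2 <= m.
Proof.
move=> H; rewrite ell2_normE; apply: limr_le; first exact: ell2_cvg.
by apply: nearW => N; rewrite /series/= big_mkord; exact: H.
Qed.

Lemma partial_cvg y (e : R) : 0 < e ->
  exists N, nrm y ^+ 2 - e < \sum_(k < N) normc (y k) ^+ 2.
Proof.
move=> e0; apply/not_existsP => H.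
have : nrm y ^+ 2 <= nrm y ^+ 2 - e.
  by apply: norm_le_partial => N; rewrite leNgt; apply/negP/H.
by rewrite leNgt ltrBlDr ltrDl e0.
Qed.

Lemma amgm_normc (u v : R[i]) : normc (u^* * v) <= (normc u ^+ 2 + normc v ^+ 2) / 2.
Proof.
have -> : normc (u^* * v) = normc u * normc v :> R.
  by rewrite normcM; congr (_ * _); case: (u) => p q /=; rewrite sqrrN.
have := sqr_ge0 (normc u - normc v); clear; lra.
Qed.

Lemma normcB_sqr (u v : R[i]) : normc (v - u) ^+ 2 =
  normc v ^+ 2 + normc u ^+ 2 - 2 * Re (u^* * v) :> R.
Proof.
rewrite !sqr_normcE; case: u v => [u1 u2] [v1 v2]; simpc => /=; ring.
Qed.

Lemma Re_sum N (F : 'I_N -> R[i]) : Re (\sum_(k < N) F k) = \sum_(k < N) Re (F k).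
Proof. by elim/big_rec2: _ => //= k p q _ <-; case: (F k) q => [? ?] [? ?]. Qed.

(** Termwise arithmetic-geometric mean. For vectors of norm at most 1 it yields the bound 1, as
    Cauchy-Schwarz would. *)
Lemma fdot_le N a y :
  normc (fdot N a y) <= (\sum_(k < N) normc (a k) ^+ 2 + nrm y ^+ 2) / 2.
Proof.
apply: (@le_trans _ _ (\sum_(k < N) normc ((a k)^* * y k))).
  rewrite /fdot; elim/big_ind2: _ => //; first by rewrite normc0.
  by move=> p q p' q' h1 h2; apply: le_trans (normc_triangle _ _) _; exact: lerD.
apply: (@le_trans _ _ ((\sum_(k < N) normc (a k) ^+ 2 +
    \sum_(k < N) normc (y k) ^+ 2) / 2)); last first.
  by rewrite ler_pM2r ?invr_gt0// lerD2l partial_le.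
rewrite -big_split/= mulr_suml; apply: ler_sum => k _; exact: amgm_normc.
Qed.

Lemma fdot_self N a : fdot N a a = (\sum_(k < N) normc (a k) ^+ 2)%:C.
Proof.
rewrite rmorph_sum/=; apply: eq_bigr => k _.
by rewrite sqr_normcE; case: (a k) => p q; simpc => /=; congr (_ +i* _); ring.
Qed.

Lemma fdotB N a y y' : fdot N a (y - y') = fdot N a y - fdot N a y'.
Proof. by rewrite /fdot -sumrB; apply: eq_bigr => k _; rewrite -mulrBr. Qed.

Lemma fdot_partial N a y : \sum_(k < N) normc (y k - a k) ^+ 2 =
  \sum_(k < N) normc (y k) ^+ 2 + \sum_(k < N) normc (a k) ^+ 2 - 2 * Re (fdot N a y).
Proof.
rewrite /fdot Re_sum mulr_sumr -big_split/= -sumrB.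
by apply: eq_bigr => k _; rewrite normcB_sqr.
Qed.

(** The product sees only [N] coordinates, but the unit bounds control the tail. The first [N] terms
    sum to [T N], and [T N <= 2 * T N]; each later term is at most twice
    [normc (y k) ^+ 2 + normc (a k) ^+ 2]. The total is at most 2 + 2 minus four times the real
    part, whatever [N] is. *)
Lemma peak_near N a y : nrm a <= 1 -> nrm y <= 1 ->
  nrm (y - a) ^+ 2 <= 4 * (1 - Re (fdot N a y)).
Proof.
move=> a1 y1; apply: norm_le_partial => M.
pose T M := \sum_(k < M) normc (y k - a k) ^+ 2.
have sq1 (v : ell2 R) : nrm v <= 1 -> nrm v ^+ 2 <= 1.
  by move=> v1; rewrite expr_le1 ?ell2_norm_ge0.
pose S v M := \sum_(k < M) normc ((v : ell2 R) k) ^+ 2.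
have S1 v K : nrm v <= 1 -> S v K <= 1.
  by move=> /sq1; apply: le_trans; exact: partial_le.
have TK K : (N <= K)%N -> T K <= 2 * S y K + 2 * S a K - 4 * Re (fdot N a y).
  move=> NK; rewrite -(subnKC NK); elim: (K - N)%N => [|m IH].
    rewrite addn0 /T fdot_partial -/(S y N) -/(S a N).
    have : 0 <= T N by apply: sumr_ge0 => k _; exact: sqr_ge0.
    by rewrite /T fdot_partial -/(S y N) -/(S a N); clear; lra.
  rewrite addnS /T /S !big_ord_recr/= -/(T _) -/(S y _) -/(S a _).
  have : normc (y (N + m)%N - a (N + m)%N) ^+ 2 <=
      2 * normc (y (N + m)%N) ^+ 2 + 2 * normc (a (N + m)%N) ^+ 2.
    rewrite !sqr_normcE; case: (y _) (a _) => [p q] [p' q'] /=.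
    by have := sqr_ge0 (p + p'); have := sqr_ge0 (q + q'); clear; nra.
  by move: IH; clear; lra.
have TM : T M <= T (maxn M N).
  rewrite /T -!(big_mkord xpredT (fun k => normc (y k - a k) ^+ 2)).
  rewrite (@big_cat_nat _ _ _ M 0 (maxn M N))//= ?leq_maxl// lerDl.
  by apply: sumr_ge0 => k _; exact: sqr_ge0.
have := TK _ (leq_maxr M N).
have := S1 y (maxn M N) y1; have := S1 a (maxn M N) a1.
move: TM; rewrite -[\sum_(_ < M) _]/(T M); clear; lra.
Qed.

End Functionals.

(** * Boundary behaviour of [g] and of functions in the ball algebra *)

Section Boundary.
Variable R : realType.
Implicit Types (r t : R) (z c : R[i]) (y a b : ell2 R) (x w : unit_ball R).
Local Notation Re := complex.Re.
Local Notation Im := complex.Im.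
Local Notation nrm := (@ell2_norm R).

Lemma holomorphic_continuous (V : normedModType R[i]) (h : unit_ball R -> V) x (e : R[i]) :
  holomorphic h -> 0 < e -> exists2 d : R, 0 < d &
    forall w, nrm (val w - val x) < d -> `|h w - h x| < e.
Proof.
move=> hh e0; have := differentiable_continuous (hh x).
move=> /cvgrPdist_lt/(_ _ e0)/nbhs_ballP[_ /= /pos_complexP[d d0 ->] dP].
exists d => // w wx; have := dP (val w); rewrite !zero_extE distrC; apply.
by rewrite -ball_normE/= distrC ell2_norm_lt.
Qed.

Lemma normc_lipschitz z c : `|normc z - normc c| <= normc (z - c).
Proof.
rewrite ler_norml; apply/andP; split.
  rewrite lerNl opprB lerBlDr -(normcN (z - c)) opprB.
  by apply: le_trans (normc_triangle _ _); rewrite subrK.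
by rewrite lerBlDr; apply: le_trans (normc_triangle _ _); rewrite subrK.
Qed.

Lemma ell2_normB_sym y y' : nrm (y - y') = nrm (y' - y).
Proof. by apply/complexI; rewrite -!ell2_normCE distrC. Qed.

Lemma ell2_dist_triangle a y b : nrm (y - b) <= nrm (y - a) + nrm (b - a).
Proof.
rewrite (ell2_normB_sym b a) (_ : y - b = (y - a) + (a - b)); last by rewrite addrA subrK.
exact: ell2_normD.
Qed.

Lemma norm_le1_sqr y : nrm y <= 1 -> nrm y ^+ 2 <= 1.
Proof. by move=> y1; rewrite expr_le1 ?ell2_norm_ge0. Qed.

Section Inner.
Variables (g : unit_ball R -> ell2 R) (gbar : ell2 R -> ell2 R).
Hypothesis ghol : holomorphic g.
Hypothesis gbd : forall y, nrm y = 1 -> nrm (gbar y) = 1.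
Hypothesis gcont : forall y, nrm y = 1 -> forall e : R, 0 < e ->
  exists2 d : R, 0 < d & forall w, nrm (val w - y) < d -> nrm (g w - gbar y) < e.

Lemma inner_le1 x : nrm (g x) <= 1.
Proof.
rewrite -(@expr_le1 _ 2)// ?ell2_norm_ge0//; apply: norm_le_partial => N.
set s := \sum_(k < N) _.
(* The maximum principle acts on the second argument only, with [g x] frozen in the first. The
   estimate improves itself: [s <= (s + 1) / 2] forces [s <= 1]. *)
have : normc (fdot R N (g x) (g x)) <= (s + 1) / 2.
  apply: (ball_max_principle R (fun w => fdot R N (g x) (g w))).
    exact: holomorphic_fdot.
  move=> y y1 e e0; pose e1 := Num.min 1 (e / 2).
  have e10 : 0 < e1 by rewrite lt_min ltr01 divr_gt0.
  have [d d0 dP] := gcont y y1 e1 e10; exists d => // w /dP.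
  rewrite lt_min => /andP[h1 h2].
  apply: le_trans (fdot_le _ _ _ _) _; rewrite -/s.
  have : nrm (g w) <= 1 + nrm (g w - gbar y).
    by rewrite -(gbd y y1) -[X in nrm X <= _](subrKC (gbar y)); exact: ell2_normD.
  set eta := nrm (g w - gbar y) in h1 h2 *; have eta0 : 0 <= eta by exact: ell2_norm_ge0.
  rewrite -(@ler_pXn2r _ 2) ?nnegrE ?ell2_norm_ge0 ?addr_ge0// => h3.
  have : eta ^+ 2 <= eta by rewrite expr2 ler_piMr// ltW.
  by move: h3; rewrite sqrrD expr1n mul1r; move: h2 e0; clear; lra.
rewrite fdot_self normc_real -/s => H; have := le_trans (ler_norm s) H; clear; lra.
Qed.

(* With [a = g x0], [|g - a|^2 <= |g|^2 + |a|^2 - 2 Re <g, a>], a holomorphic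
   majorant whose value at [x0] tends to 0 with the truncation error. *)
Lemma inner_constant x0 : nrm (g x0) = 1 -> forall x, g x = g x0.
Proof.
move=> g1; apply: (ball_chain R (fun x => g x = g x0)); first by exists x0.
move=> x gx w wx; apply/val_inj/funext => k /=.
pose u v : R := normc (g v k - g x0 k) ^+ 2.
suff : u w = 0.
  move=> /eqP; rewrite sqrf_eq0 => /eqP/eq0_normc/eqP.
  by rewrite subr_eq0 => /eqP.
apply: (local_strong_max R u x) wx => [||e e0].
- move=> v e e0; set b := normc (g v k - g x0 k).
  have b1 : 0 < 2 * b + 1 by rewrite ltr_wpDl// mulr_ge0// normc_ge0.
  have m0 : 0 < Num.min 1 (e / (2 * b + 1)) by rewrite lt_min ltr01 divr_gt0.
  have [d d0 dP] := holomorphic_continuous _ _ v _ (holomorphic_coord_comp R g k ghol)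
    (ltac:(by rewrite ltcR) : 0 < (Num.min 1 (e / (2 * b + 1)))%:C).
  exists d => // v' /dP; rewrite normcE_real ltcR lt_min => /andP[h1 h2].
  rewrite /u -/b; set a := normc (g v' k - g x0 k).
  have ab : `|a - b| <= normc (g v' k - g v k).
    have -> : g v' k - g v k = (g v' k - g x0 k) - (g v k - g x0 k).
      by rewrite opprB addrA subrK.
    exact: normc_lipschitz.
  have a0 : 0 <= a by exact: normc_ge0.
  have b0 : 0 <= b by exact: normc_ge0.
  rewrite subr_sqr normrM (ger0_norm (addr_ge0 a0 b0)).
  apply: (@le_lt_trans _ _ (`|a - b| * (2 * b + 1))).
    apply: ler_wpM2l => //; have := le_lt_trans (le_trans (ler_norm _) ab) h1.
    by clear; lra.
  by rewrite -ltr_pdivlMr//; exact: le_lt_trans ab h2.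
- by move=> v; exact: sqr_ge0.
have [N NP] := partial_cvg R (g x0) e e0; rewrite g1 expr1n in NP.
(* Past [N] the truncation error is below [e]; past [k] the sum contains the coordinate under
   study. *)
pose M := maxn N k.+1.
pose s := \sum_(j < M) normc (g x0 j) ^+ 2.
have sP : 1 - e < s.
  apply: lt_le_trans NP _; rewrite /s -!(big_mkord xpredT (fun j => normc (g x0 j) ^+ 2)).
  rewrite (@big_cat_nat _ _ _ N 0 M)//= ?leq_maxl// lerDl.
  by apply: sumr_ge0 => j _; exact: sqr_ge0.
pose f := fun v => fdot R M (g x0) (g v).
have hf : holomorphic f by exact: holomorphic_fdot.
exists ((- 2) *: f + (fun=> (1 + s)%:C)).
  by apply: holomorphic_lin => //; exact: holomorphic_cst.
have E v : Re (((- 2) *: f + (fun=> (1 + s)%:C)) v) = 1 + s - 2 * Re (f v).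
  rewrite -[(_ + _) v]/(- 2 * f v + (1 + s)%:C).
  by case: (f v) => p q; simpc => /=; ring.
split=> [v|]; rewrite E; last first.
  by rewrite /f gx fdot_self -/s /=; move: sP; clear; lra.
apply: (@le_trans _ _ (\sum_(j < M) normc (g v j - g x0 j) ^+ 2)).
  have kM : (k < M)%N by rewrite leq_maxr.
  rewrite (bigD1 (Ordinal kM))//= lerDl.
  by apply: sumr_ge0 => j _; exact: sqr_ge0.
rewrite fdot_partial -/s -/(f v) lerB// lerD2r.
by apply: le_trans (partial_le _ _ _) _; apply: norm_le1_sqr; exact: inner_le1.
Qed.

End Inner.

Lemma ball_near y (d : R) : nrm y <= 1 -> 0 < d -> exists w, nrm (val w - y) < d.
Proof.
move=> y1 d0; pose s : R := Num.min 1 (d / 2).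
have s0 : 0 < s by rewrite lt_min ltr01 divr_gt0.
have s1 : s <= 1 by rewrite ge_min lexx.
have sd : s < d.
  apply: (@le_lt_trans _ _ (d / 2)); first by rewrite ge_min lexx orbT.
  by rewrite ltr_pdivrMr// ltr_pMr// ltr1n.
have [|w wE] := mk_ball R ((1 - s)%:C *: y).
  rewrite ell2_normZ normc_real ger0_norm ?subr_ge0//.
  apply: (@le_lt_trans _ _ (1 - s)); last by rewrite gtrBl.
  by rewrite ler_piMr// subr_ge0.
exists w; rewrite wE rmorphB scalerBl scale1r addrAC subrr add0r -scaleNr.
rewrite ell2_normZ normcN normc_real gtr0_norm//.
by apply: le_lt_trans sd; rewrite ler_piMr// ltW.
Qed.

Lemma Au_hol (f : Au R) : holomorphic f /\ unif_continuous_on_ball f.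
Proof. by case: f => f /= /Au_predP. Qed.

Lemma Hoo_hol (f : Hoo R) : holomorphic f /\ bounded_on_ball f.
Proof. by case: f => f /= /Hoo_predP. Qed.

Lemma Au_unif (f : Au R) (e : R) : 0 < e -> exists2 d : R, 0 < d &
  forall w w', nrm (val w - val w') < d -> normc (f w - f w') < e.
Proof.
move=> e0; have [_ uf] := Au_hol f.
have [_ /pos_complexP[d d0 ->] dP] := uf e%:C ltac:(by rewrite ltcR).
by exists d => // w w'; rewrite -ell2_norm_lt => /dP; rewrite normcE_real ltcR.
Qed.

(** Uniform continuity makes the values along a sequence tending to [y] Cauchy, in real and
    imaginary parts separately, and ties the values at all points near [y] to their limit. *)
Lemma Au_limit (f : Au R) y : nrm y <= 1 -> exists l : R[i], forall e : R, 0 < e ->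
  exists2 d : R, 0 < d & forall w, nrm (val w - y) < d -> normc (f w - l) <= e.
Proof.
move=> y1.
have u0 n : (0 : R) < n.+1%:R^-1 by rewrite invr_gt0 ltr0n.
have /choice[u uP] := fun n => ball_near y _ y1 (u0 n).
have small (d : R) : 0 < d -> exists N, forall n, (N <= n)%N -> nrm (val (u n) - y) < d.
  move=> d0; exists (Num.truncn d^-1) => n nN; apply: lt_trans (uP n) _.
  rewrite invf_plt ?posrE ?ltr0n//; apply: lt_le_trans (truncnS_gt _) _.
  by rewrite ler_nat ltnS.
have near2 (d : R) w w' : nrm (val w - y) < d / 2 -> nrm (val w' - y) < d / 2 ->
    nrm (val w - val w') < d.
  move=> h1 h2; rewrite (splitr d); apply: le_lt_trans (ltrD h1 h2).
  exact: ell2_dist_triangle.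
have cau (F : R[i] -> R) : (forall z z', `|F z - F z'| <= normc (z - z')) ->
    cvgn (fun n => F (f (u n))).
  move=> FL; apply/cauchy_cvgP/cauchy_exP => e e0.
  have [d d0 dP] := Au_unif f e e0.
  have [N NP] := small (d / 2) ltac:(by rewrite divr_gt0).
  exists (F (f (u N))); exists N => // n /= /NP h; rewrite /ball/=.
  by apply: le_lt_trans (FL _ _) _; apply: dP; exact: near2 (NP _ (leqnn N)) h.
have cRe := cau (@complex.Re R) (fun z z' => ltac:(rewrite -ReB; exact: normc_Re)).
have cIm := cau (@complex.Im R) (fun z z' => ltac:(rewrite -ImB; exact: normc_Im)).
exists (limn (fun n => Re (f (u n))) +i* limn (fun n => Im (f (u n)))) => e e0.
set l := _ +i* _.
have [d d0 dP] := Au_unif f (e / 2) ltac:(by rewrite divr_gt0).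
exists (d / 2); first by rewrite divr_gt0.
move=> w wy; have [N NP] := small (d / 2) ltac:(by rewrite divr_gt0).
have e4 : 0 < e / 2 / 2 by rewrite !divr_gt0.
have /cvgrPdist_lt/(_ _ e4)[N1 _ N1P] := cRe.
have /cvgrPdist_lt/(_ _ e4)[N2 _ N2P] := cIm.
pose n := maxn N (maxn N1 N2).
have := N1P n; rewrite /= leq_max leq_maxl orbT => /(_ isT) h1.
have := N2P n; rewrite /= leq_max leq_maxr orbT => /(_ isT) h2.
have h3 := dP w (u n) (near2 _ _ _ wy (NP n (leq_maxl _ _))).
rewrite -(subrK (f (u n)) (f w)) -addrA.
apply: le_trans (normc_triangle _ _) _; rewrite (splitr e); apply: lerD; first exact: ltW.
apply: le_trans (normc_le_sum _ _) _; rewrite ReB ImB (splitr (e / 2)).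
by apply: lerD; rewrite distrC ltW.
Qed.

End Boundary.

(** * Characters of the ball algebra *)

Section Characters.
Variable R : realType.
Implicit Types (r t : R) (z c : R[i]) (y a b : ell2 R) (x w : unit_ball R).
Local Notation Re := complex.Re.
Local Notation nrm := (@ell2_norm R).

(** [Au_ext] is a [lim] along this filter; properness, that is, adherence of [y] to the open ball,
    makes that limit unique. *)
Lemma within_ball_proper y : nrm y <= 1 ->
  ProperFilter (within [set z : ell2 R | `|z| < 1] (nbhs y)).
Proof.
move=> y1; apply: Build_ProperFilter_ex => A.
move=> /nbhs_ballP[_ /= /pos_complexP[d d0 ->] dP].
have [w wy] := ball_near R y d y1 d0.
exists (val w); apply: dP; last by case: (w).
by rewrite -ball_normE/= distrC ell2_norm_lt.
Qed.

Lemma Au_ext_cvg_of (f : Au R) y (l : R[i]) :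
  (forall e : R, 0 < e -> exists2 d : R, 0 < d &
    forall w, nrm (val w - y) < d -> normc (f w - l) <= e) ->
  zero_ext f z @[z --> within [set z : ell2 R | `|z| < 1] (nbhs y)] --> l.
Proof.
move=> H; apply/cvgrPdist_le => _ /pos_complexP[e e0 ->].
have [d d0 dP] := H e e0.
apply/nbhs_ballP; exists d%:C; first by rewrite /= ltcR.
move=> z; rewrite -ball_normE/= distrC ell2_norm_lt => zy z1.
rewrite -[z]/(val (in_ball z1)) zero_extE distrC normcE_real lecR.
exact: dP.
Qed.

Lemma Au_ext_unique (f : Au R) y (l : R[i]) : nrm y <= 1 ->
  (forall e : R, 0 < e -> exists2 d : R, 0 < d &
    forall w, nrm (val w - y) < d -> normc (f w - l) <= e) -> Au_ext f y = l.
Proof.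
move=> y1 H; have PF := within_ball_proper _ y1.
by apply: cvg_lim; [exact: norm_hausdorff|exact: Au_ext_cvg_of].
Qed.

Lemma Au_ext_approx (f : Au R) y (e : R) : nrm y <= 1 -> 0 < e ->
  exists2 d : R, 0 < d &
    forall w, nrm (val w - y) < d -> normc (f w - Au_ext f y) <= e.
Proof.
move=> y1 e0; have [l lP] := Au_limit R f y y1.
by rewrite (Au_ext_unique f y l y1 lP); exact: lP.
Qed.

Lemma Au_ext_cvg (f : Au R) y : nrm y <= 1 ->
  zero_ext f z @[z --> within [set z : ell2 R | `|z| < 1] (nbhs y)] --> Au_ext f y.
Proof. by move=> y1; apply: Au_ext_cvg_of => e; exact: Au_ext_approx. Qed.

Lemma Au_ext_lin c (f h : Au R) y : nrm y <= 1 ->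
  Au_ext (c *: f + h) y = c *: Au_ext f y + Au_ext h y.
Proof.
move=> y1; have PF := within_ball_proper _ y1.
apply: cvg_lim; first exact: norm_hausdorff.
have -> : zero_ext (c *: f + h : Au R) = (c \*: zero_ext f) + zero_ext h.
  apply/funext => z; rewrite -[RHS]/(c *: zero_ext f z + zero_ext h z) /zero_ext.
  by case: insubP => [//|_] /=; rewrite scaler0 addr0.
by apply: cvgD; [apply: cvgZ; first exact: cvg_cst|]; exact: Au_ext_cvg.
Qed.

Lemma Au_extM (f h : Au R) y : nrm y <= 1 ->
  Au_ext (f * h) y = Au_ext f y * Au_ext h y.
Proof.
move=> y1; have PF := within_ball_proper _ y1.
apply: cvg_lim; first exact: norm_hausdorff.
have -> : zero_ext (f * h : Au R) = zero_ext f * zero_ext h.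
  apply/funext => z; rewrite -[RHS]/(zero_ext f z * zero_ext h z) /zero_ext.
  by case: insubP => [//|_] /=; rewrite mulr0.
by apply: cvgM; exact: Au_ext_cvg.
Qed.

Lemma Au_ext_coord n y : nrm y <= 1 -> Au_ext (Defs.coord R n) y = y n.
Proof.
move=> y1; apply: Au_ext_unique => // e e0; exists e => // w wy.
rewrite [Au_fun _ _]ell2_dot_canonical.
rewrite -[X in normc X]/((val w - y : ell2 R) n).
by apply: le_trans (normc_le_ell2_norm _ _) _; exact: ltW.
Qed.

Lemma Au_ext1 y : nrm y <= 1 -> Au_ext (1 : Au R) y = 1.
Proof.
move=> y1; apply: Au_ext_unique => // e e0; exists 1 => // w _.
by rewrite [X in normc X](_ : _ = 0) ?normc0 ?ltW//; exact: subrr.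
Qed.

Lemma Au_bounded (f : Au R) : exists2 M : R, 0 <= M & forall w, normc (f w) <= M.
Proof.
have [_ /unif_continuous_bounded[M MP]] := Au_hol R f.
have MR w : normc (f w) <= Re M.
  by have := MP w; rewrite normcE_real lecE => /andP[].
have [w _] := ball_near R 0 1 ltac:(by rewrite ell2_norm0) ltr01.
by exists (Re M) => //; apply: le_trans (MR w); exact: normc_ge0.
Qed.

Lemma Au_ext_bounded (f : Au R) (M : R) y : nrm y <= 1 -> (forall w, normc (f w) <= M) ->
  normc (Au_ext f y) <= M.
Proof.
move=> y1 fM; apply/ler_addgt0Pr => e e0.
have [d d0 dP] := Au_ext_approx f y e y1 e0.
have [w wy] := ball_near R y d y1 d0.
rewrite -(subKr (f w) (Au_ext f y)); apply: le_trans (normc_triangle _ _) _.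
by rewrite normcN; apply: lerD => //; exact: dP.
Qed.

(** Being bounded below makes $1/f$ uniformly continuous, since $|1/f(w) - 1/f(w')| \le |f(w) -
    f(w')|/m^2$. *)
Lemma inv_Au (f : Au R) (m : R) : 0 < m -> (forall w, m <= normc (f w)) ->
  exists k : Au R, f * k = 1.
Proof.
move=> m0 fm.
have f0 w : f w != 0.
  by apply: contraTneq (fm w) => ->; rewrite normc0 -ltNge.
have [hf _] := Au_hol R f.
suff kA : (fun w => (f w)^-1) \in @Au_pred R.
  exists (MkAu kA); apply/val_inj/funext => w.
  by rewrite -[LHS]/(f w * (f w)^-1) mulfV.
apply/Au_predP; split.
  apply: (holomorphicP (F := fun y => (zero_ext f y)^-1)) => x.
    by rewrite zero_extE.
  by apply: differentiableV => //; rewrite zero_extE.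
move=> _ /pos_complexP[e e0 ->].
have [d d0 dP] := Au_unif R f (e * m ^+ 2) ltac:(by rewrite mulr_gt0 ?exprn_gt0).
exists d%:C; first by rewrite ltcR.
move=> w w'; rewrite ell2_norm_lt => /dP H.
rewrite normcE_real ltcR.
have -> : (f w)^-1 - (f w')^-1 = (f w)^-1 * (f w')^-1 * - (f w - f w').
  by field; rewrite !f0.
rewrite !normcM !normcV normcN.
have p w1 : 0 < normc (f w1) by exact: lt_le_trans m0 (fm w1).
rewrite mulrC -invfM ltr_pdivrMr ?mulr_gt0//; apply: lt_le_trans H _.
by rewrite ler_pM2l// expr2; apply: ler_pM => //; exact: ltW.
Qed.

(** If [m < normc (phi f)], then [phi f *: 1 - f] is bounded below, hence invertible; but [phi]
    sends it to 0. *)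
Lemma character_le (phi : {linear Au R -> R[i]}) (f : Au R) (m : R) :
  {morph phi : f h / f * h} -> phi 1 = 1 -> (forall w, normc (f w) <= m) ->
  normc (phi f) <= m.
Proof.
move=> phiM phi1 fm; rewrite leNgt; apply/negP => mf.
pose h : Au R := phi f *: (1 : Au R) - f.
have [|w|k hk] := inv_Au h (normc (phi f) - m); first by rewrite subr_gt0.
  rewrite -[h w]/(phi f * 1 - f w) mulr1 lerBlDr.
  apply: le_trans (_ : normc (phi f - f w) + normc (f w) <= _); last by rewrite lerD2l.
  by apply: le_trans (normc_triangle _ _); rewrite subrK.
have := phiM h k; rewrite hk phi1 /h linearB/= linearZ/= phi1.
by rewrite /GRing.scale/= mulr1 subrr mul0r => /eqP; rewrite oner_eq0.
Qed.

(** A finite combination of coordinates, so linearity alone computes its value under a character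
    from the coordinates of that character. *)
Definition peak N a : Au R := 2^-1 *: (1 + \sum_(k < N) (a k)^* *: Defs.coord R k).

Lemma peakE N a w : peak N a w = 2^-1 * (1 + fdot R N a (val w)).
Proof.
rewrite -[LHS]/(2^-1 * (1 + (\sum_(k < N) (a k)^* *: Defs.coord R k) w)).
congr (_ * (1 + _)); rewrite /fdot.
have -> (F : 'I_N -> Au R) : (\sum_(k < N) F k) w = \sum_(k < N) F k w.
  by elim/big_rec2: _ => // k p q _ <-.
apply: eq_bigr => k _; rewrite -[LHS]/((a k)^* * Defs.coord R k w).
by congr (_ * _); exact: ell2_dot_canonical.
Qed.

Lemma Au_expE (f : Au R) n w : (f ^+ n) w = f w ^+ n.
Proof.
elim: n => [//|n IH]; rewrite !exprS -IH.
by [].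
Qed.

Lemma normcX z n : normc (z ^+ n) = normc z ^+ n.
Proof. by elim: n => [|n IH]; rewrite ?normc1// !exprS normcM IH. Qed.

Lemma bernoulli_le (u : R) n : 0 <= u <= 1 -> 1 - n%:R * u <= (1 - u) ^+ n.
Proof.
move=> /andP[u0 u1]; elim: n => [|n IH]; first by rewrite mul0r subr0 expr0.
rewrite exprS; apply: (@le_trans _ _ ((1 - u) * (1 - n%:R * u))).
  rewrite -natr1; have : 0 <= n%:R * u ^+ 2 by rewrite mulr_ge0// sqr_ge0.
  by clear; lra.
by rewrite ler_wpM2l// subr_ge0.
Qed.

(** The crude factor [N%:R] is harmless: [N] is fixed before the distance to [a]. *)
Lemma fdot_le_dist N a y : nrm a <= 1 -> normc (fdot R N a y) <= N%:R * nrm y.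
Proof.
move=> a1; rewrite /fdot; elim: N => [|N IH]; first by rewrite big_ord0 normc0 mul0r.
rewrite big_ord_recr/= -natr1 mulrDl mul1r; apply: le_trans (normc_triangle _ _) _.
apply: lerD => //; rewrite normcM -[leRHS]mul1r.
have conjE u : normc (u^*)%C = normc u :> R by case: u => p q /=; rewrite sqrrN.
rewrite conjE; apply: ler_pM; rewrite ?normc_ge0 ?normc_le_ell2_norm//.
by apply: le_trans a1; exact: normc_le_ell2_norm.
Qed.

(* With [peak_near] this makes [peak N a] a peak function at [a], uniformly in
   the truncation index [N]. *)
Lemma peak_normc N a w : nrm a <= 1 ->
  normc (peak N a w) ^+ 2 <= (1 + Re (fdot R N a (val w))) / 2.
Proof.
move=> a1; rewrite peakE.
have : normc (fdot R N a (val w)) ^+ 2 <= 1.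
  rewrite expr_le1// ?normc_ge0//; apply: le_trans (fdot_le _ _ _ _) _.
  rewrite ler_pdivrMr// mul1r.
  have := partial_le R a N; have := norm_le1_sqr R a a1.
  have := norm_le1_sqr R (val w) (ltW (ball_norm R w)); clear; lra.
have half : (2^-1 : R[i]) = (2^-1 : R)%:C by rewrite fmorphV rmorph_nat.
rewrite half !sqr_normcE; case: (fdot _ _ _ _) => p q; simpc => /=.
clear; nra.
Qed.

(* For [n] large, [peak N a ^+ n * (f - f w)] is uniformly small: [f - f w] is
   small where [peak N a] is close to 1. A character contracts the sup norm and
   has [phi (peak N a)] close to 1. *)
Theorem character_near_peak (f : Au R) a (e : R) : nrm a = 1 -> 0 < e ->
  exists2 d : R, 0 < d & forall (phi : {linear Au R -> R[i]}) y w,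
    {morph phi : f h / f * h} -> phi 1 = 1 ->
    (forall n, phi (Defs.coord R n) = y n) ->
    nrm (y - a) < d -> nrm (val w - a) < d -> normc (phi f - f w) <= e.
Proof.
move=> a1 e0.
have a1' : nrm a <= 1 by rewrite a1.
have e2 : 0 < e / 2 by rewrite divr_gt0.
have [d0 d00 d0P] := Au_unif R f (e / 2) e2.
have [M M0 MP] := Au_bounded f.
(* By [peak_near], a real part above [1 - del] puts [v] within [d0 / 2] of [a], since
   [4 * del <= (d0 / 2) ^+ 2]. *)
pose del := Num.min 1 ((d0 / 4) ^+ 2).
have del0 : 0 < del by rewrite lt_min ltr01 exprn_gt0// divr_gt0.
have del1 : del <= 1 by rewrite ge_min lexx.
have deld : del <= (d0 / 4) ^+ 2 by rewrite ge_min lexx orbT.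
(* By [peak_normc], the bound for the modulus of the peak function where the real part is at most
   [1 - del]. *)
pose th := Num.sqrt (1 - del / 2).
have th2 : th ^+ 2 = 1 - del / 2 by rewrite sqr_sqrtr//; move: del1; clear; lra.
have th0 : 0 <= th by exact: sqrtr_ge0.
have th1 : th < 1.
  by rewrite -(@expr_lt1 _ 2)// th2; move: del0; clear; lra.
have [n nP] : exists n, th ^+ n * (2 * M) <= e / 2.
  have M1 : 0 < 2 * M + 1 by rewrite ltr_wpDl// mulr_ge0.
  have : th ^+ n @[n --> \oo] --> (0 : R) by apply: cvg_expr; rewrite ger0_norm.
  move=> /cvgrPdist_lt/(_ (e / 2 / (2 * M + 1)) ltac:(by rewrite !divr_gt0))[n _ nP].
  exists n; have := nP n (leqnn n); rewrite /= sub0r normrN ger0_norm ?exprn_ge0//.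
  rewrite ltr_pdivlMr// => /ltW; apply: le_trans.
  by rewrite ler_wpM2l ?exprn_ge0// lerDl.
(* Bernoulli then gives [1 / 2 <= (1 - eta) ^+ n], so the power of the peak function costs only a
   factor 2 in the final division. *)
pose eta : R := (2 * n.+1%:R)^-1.
have eta0 : 0 < eta by rewrite invr_gt0 mulr_gt0// ltr0n.
have eta1 : eta <= 1.
  by rewrite invf_le1 ?mulr_gt0 ?ltr0n// -natrM ler1n.
have neta : n%:R * eta <= 1 / 2.
  rewrite /eta ler_pdivrMr ?mulr_gt0 ?ltr0n// mulrA mul1r mulVf// mul1r ler_nat//.
have [N NP] := partial_cvg R a eta eta0; rewrite a1 expr1n in NP.
have N0 : (0 : R) < N%:R + 1 by rewrite ltr_wpDl.
have minl (u v : R) : Num.min u v <= u by rewrite ge_min lexx.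
have minr (u v : R) : Num.min u v <= v by rewrite ge_min lexx orbT.
exists (Num.min (d0 / 2) (eta / (N%:R + 1))); first by rewrite lt_min !divr_gt0.
move=> phi y w phiM phi1 phiy.
move=> /lt_le_trans/(_ (minr _ _)) ya /lt_le_trans/(_ (minl _ _)) wa.
pose F : Au R := f - f w *: (1 : Au R).
have phiF : phi F = phi f - f w.
  by rewrite /F linearB/= linearZ/= phi1 /GRing.scale/= mulr1.
have FE v : F v = f v - f w by rewrite -[LHS]/(f v - f w * 1) mulr1.
have Fsmall : normc (phi (peak N a ^+ n * F)) <= e / 2.
  apply: character_le => // v.
  rewrite -[(_ * F) v]/((peak N a ^+ n) v * F v) Au_expE normcM FE.
  rewrite normcX.
  have pv := peak_normc N a v a1'.
  have near_v := peak_near R N a (val v) a1' (ltW (ball_norm R v)).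
  have [re|re] := ltP (1 - del) (Re (fdot R N a (val v))).
    have va : nrm (val v - a) < d0 / 2.
      rewrite -(@ltr_pXn2r _ 2) ?nnegrE ?ell2_norm_ge0 ?divr_ge0 ?(ltW d00)//.
      apply: le_lt_trans near_v _; move: re deld; rewrite !expr_div_n -!natrX.
      by clear; lra.
    have Fv : normc (f v - f w) < e / 2.
      apply: d0P; apply: le_lt_trans (ell2_dist_triangle R a (val v) (val w)) _.
      by rewrite (splitr d0); exact: ltrD va wa.
    apply: le_trans (ltW Fv); rewrite ler_piMl ?normc_ge0//.
    rewrite exprn_ile1 ?normc_ge0// -(@expr_le1 _ 2) ?normc_ge0//.
    apply: le_trans pv _; have := le_trans (sqr_ge0 _) near_v.
    by clear; lra.
  apply: le_trans nP; apply: ler_pM; rewrite ?exprn_ge0 ?normc_ge0//.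
    apply: lerXn2r; rewrite ?nnegrE ?normc_ge0//.
    rewrite -(@ler_pXn2r _ 2) ?nnegrE ?normc_ge0// th2.
    by apply: le_trans pv _; move: re; clear; lra.
  apply: le_trans (normc_triangle _ _) _; rewrite normcN mulr_natl mulr2n.
  by apply: lerD; exact: MP.
have phip : phi (peak N a) = 2^-1 * (1 + fdot R N a y).
  rewrite /peak linearZ/= linearD/= phi1 linear_sum/=; congr (_ * (1 + _)).
  by apply: eq_bigr => k _; rewrite linearZ/= phiy.
(* Truncating [a] and replacing [a] by [y] each lose at most [eta] in the real part; the factor 1/2
   in [peak] turns this into a total loss of [eta]. *)
have pbig : 1 - eta <= normc (phi (peak N a)).
  rewrite phip; apply: le_trans (le_trans (ler_norm _) (normc_Re _ _)).
  have -> : Re (2^-1 * (1 + fdot R N a y)) = (1 + Re (fdot R N a y)) / 2.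
    have -> : (2^-1 : R[i]) = (2^-1 : R)%:C by rewrite fmorphV rmorph_nat.
    by case: (fdot _ _ _ _) => p q; simpc => /=; rewrite mulrC.
  have -> : fdot R N a y = fdot R N a a + fdot R N a (y - a).
    by rewrite fdotB subrKC.
  have ReD (u v : R[i]) : Re (u + v) = Re u + Re v by case: u v => [? ?] [].
  rewrite fdot_self ReD.
  have small : normc (fdot R N a (y - a)) <= eta.
    apply: le_trans (fdot_le_dist _ _ _ a1') _.
    apply: (@le_trans _ _ ((N%:R + 1) * nrm (y - a))).
      by rewrite ler_wpM2r ?ell2_norm_ge0// lerDl.
    by rewrite mulrC -ler_pdivlMr// ltW.
  have := le_trans (normc_Re _ _) small; rewrite ler_norml => /andP[+ _].
  by move: NP => /=; clear; lra.
have pn : 1 / 2 <= normc (phi (peak N a)) ^+ n.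
  have h1 := bernoulli_le eta n ltac:(by rewrite (ltW eta0) eta1).
  apply: le_trans (le_trans _ h1) _; first by move: neta; clear; lra.
  by apply: lerXn2r; rewrite ?nnegrE ?normc_ge0 ?subr_ge0.
have phiX m : phi (peak N a ^+ m) = phi (peak N a) ^+ m.
  by elim: m => [|m IH]; rewrite ?phi1// !exprS phiM IH.
move: Fsmall; rewrite phiM phiX phiF normcM.
rewrite normcX.
have X0 := @normc_ge0 R (phi f - f w).
have := ler_wpM2r X0 pn; clear; lra.
Qed.

End Characters.

(** * The fiber *)

Section Fiber.
Variable R : realType.
Implicit Types (r t : R) (z c : R[i]) (y a b : ell2 R) (x w : unit_ball R).
Local Notation Re := complex.Re.
Local Notation nrm := (@ell2_norm R).

(** Connectedness of the ball. A homomorphism that is merely nonzero sends 1 to a nonzero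
    idempotent, which this identifies with 1. Here [1 - Re h] takes only the values 0 and 1 and is
    its own majorant. *)
Lemma Hoo_idempotent (h : Hoo R) : h * h = h -> h != 0 -> h = 1.
Proof.
move=> hh h0; have [hol _] := Hoo_hol R h.
have h01 w : h w = 0 \/ h w = 1.
  have /eqP : h w * h w = h w by rewrite -[in RHS]hh.
  rewrite -subr_eq0 -{3}[h w]mulr1 -mulrBr mulf_eq0 subr_eq0.
  by move=> /orP[] /eqP; [left|right].
apply/val_inj/funext; apply: (ball_chain R (fun w => h w = 1)).
  apply/not_existsP => H; move/eqP: h0; apply.
  by apply/val_inj/funext => w; have [//|/H] := h01 w.
move=> x hx w wx; pose u w : R := 1 - Re (h w).
suff : u w = 0.
  by rewrite /u; have [->|//] := h01 w; rewrite subr0 => /eqP; rewrite oner_eq0.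
apply: (local_strong_max R u x) wx => [v e e0|v|e e0].
- have [d d0 dP] := holomorphic_continuous R _ _ v e%:C hol ltac:(by rewrite ltcR).
  exists d => // v' /dP; rewrite normcE_real ltcR; apply: le_lt_trans.
  by rewrite /u opprB addrC addrA subrK distrC -ReB; exact: normc_Re.
- by rewrite /u; have [->|->] := h01 v; rewrite ?subr0 ?subrr.
exists ((- 1) *: (h : unit_ball R -> R[i]) + (fun=> 1)).
  by apply: holomorphic_lin => //; exact: holomorphic_cst.
have E v : Re (((- 1) *: (h : unit_ball R -> R[i]) + (fun=> 1)) v) = u v.
  rewrite -[(_ + _) v]/(- 1 * h v + 1) mulN1r /u.
  by case: (h v) => p q; simpc => /=; rewrite addrC.
split=> [v|]; rewrite E//.
by rewrite /u hx subrr ltW.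
Qed.

End Fiber.

Theorem lemma2p10 (R : realType) (g : unit_ball R -> ell2 R)
    (gbar : ell2 R -> ell2 R)
    (gHoo : Hoo_ell2 g)
    (gbar_cont : {within [set x : ell2 R | `|x| <= 1], continuous gbar})
    (gbar_ext : forall x : unit_ball R, gbar (val x) = g x)
    (gbar_sphere : forall x : ell2 R, `|x| = 1 -> `|gbar x| = 1) :
  exists2 Cg : Au R -> Hoo R, is_composition_hom g Cg & fiber g = [set Cg].
Proof.
have [ghol _] := gHoo.
have nrm1 y : ell2_norm y = 1 -> `|y| = 1 by move=> y1; rewrite ell2_normCE y1.
have gS y : ell2_norm y = 1 -> ell2_norm (gbar y) = 1.
  by move=> /nrm1/gbar_sphere; rewrite ell2_normCE => /complexI.
have gcont y : ell2_norm y = 1 -> forall e : R, 0 < e ->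
    exists2 d : R, 0 < d &
    forall w : unit_ball R, ell2_norm (val w - y) < d -> ell2_norm (g w - gbar y) < e.
  move=> y1 e e0.
  have yD : [set x : ell2 R | `|x| <= 1] y by rewrite /= nrm1.
  have /subspace_continuousP/(_ y yD)/cvgrPdist_lt := gbar_cont.
  move=> /(_ e%:C ltac:(by rewrite ltcR))/nbhs_ballP[_ /= /pos_complexP[d d0 ->] dP].
  exists d => // w wy; rewrite ell2_normB_sym -ell2_norm_lt -gbar_ext.
  apply: dP; first by rewrite -ball_normE/= distrC ell2_norm_lt.
  by apply: ltW; case: (w).
have g1 := inner_le1 R g gbar ghol gS gcont.
have g1' x : `|g x| <= 1 by rewrite ell2_normCE lecR.
have hol_ext (f : Au R) : holomorphic (fun x => Au_ext f (g x) : R[i]).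
  (* The extension of [f] is differentiable only at interior points, so the chain rule needs [g] to
     avoid the sphere. *)
  have [[x0 gx0]|H] := pselect (exists x0, ell2_norm (g x0) = 1).
    have gc := inner_constant R g gbar ghol gS gcont x0 gx0.
    have -> : (fun x => Au_ext f (g x)) = (fun=> Au_ext f (g x0)).
      by apply/funext => x; rewrite gc.
    exact: holomorphic_cst.
  have glt x : ell2_norm (g x) < 1.
    by rewrite lt_neqAle g1 andbT; apply/eqP => gx; apply: H; exists x.
  apply: (holomorphicP (F := zero_ext f \o zero_ext g)) => x.
    have [w wE] := mk_ball R _ (glt x).
    by rewrite /= zero_extE -wE Au_ext_ball zero_extE.
  apply: differentiable_comp; first exact: ghol.
  rewrite zero_extE; have [w <-] := mk_ball R _ (glt x).
  by have [hf _] := Au_hol R f; exact: hf.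
have CgH (f : Au R) : (fun x => Au_ext f (g x)) \in @Hoo_pred R.
  apply/Hoo_predP; split; first exact: hol_ext.
  have [M _ MP] := Au_bounded R f.
  by exists M%:C => x; rewrite normcE_real lecR; exact: Au_ext_bounded.
pose Cg f := MkHoo (CgH f).
have CgE f x : Cg f x = Au_ext f (g x) by [].
exists Cg; first by [].
apply/seteqP; split=> [Phi|_ ->]; last first.
  split; last first.
    by move=> x; apply/funext => n; rewrite /xi CgE Au_ext_coord.
  split.
  - by move=> c f h; apply/val_inj/funext => x; exact: Au_ext_lin.
  - by move=> f h; apply/val_inj/funext => x; exact: Au_extM.
  - have [v _] := mk_ball R 0 ltac:(by rewrite ell2_norm0).
    exists 1; apply/eqP => /(congr1 (fun h : Hoo R => h v)).
    by rewrite CgE Au_ext1// => /eqP; rewrite oner_eq0.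
move=> [[Plin PM [f0 Pf0]] Pxi].
have P1 : Phi 1 = 1.
  apply: Hoo_idempotent; first by rewrite -PM mulr1.
  by apply: contra_neq Pf0 => P10; rewrite -[f0]mul1r PM P10 mul0r.
pose ev x (f : Au R) : R[i] := Phi f x.
have evlin x : linear (ev x).
  by move=> c f h; rewrite /ev Plin.
apply/funext => f; apply/val_inj/funext => x /=.
apply/eqP; rewrite -subr_eq0; apply/eqP; apply: eq0_normc; apply/eqP.
rewrite eq_le normc_ge0 andbT.
pose D : unit_ball R -> R[i] :=
  (- 1) *: (Cg f : unit_ball R -> R[i]) + (Phi f : unit_ball R -> R[i]).
have DE v : D v = Phi f v - Cg f v by rewrite -[LHS]/(- 1 * _ + _) mulN1r addrC.
rewrite -DE; apply: ball_max_principle.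
  by apply: holomorphic_lin; [have [] := Hoo_hol R (Cg f)|have [] := Hoo_hol R (Phi f)].
move=> y y1 e e0; rewrite add0r.
have e2 : 0 < e / 2 by rewrite divr_gt0.
have [d d0 dP] := character_near_peak R f (gbar y) (e / 2) (gS y y1) e2.
have d2 : 0 < d / 2 by rewrite divr_gt0.
have [d' d'0 d'P] := gcont y y1 (d / 2) d2.
exists d' => // w /d'P gw.
have [q q0 qP] := Au_ext_approx R f (g w) (e / 2) (g1 w) e2.
(* The point [g w] may lie on the sphere, so [Phi f w] and the extended value at [g w] are both
   compared with [f v] at an interior point [v], each within [e / 2]. *)
have [v vP] := ball_near R (g w) (Num.min q (d / 2)) (g1 w) ltac:(by rewrite lt_min q0).
move: vP; rewrite lt_min => /andP[/qP fv vd].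
have vy : ell2_norm (val v - gbar y) < d.
  apply: le_lt_trans (ell2_dist_triangle R (g w) _ _) _.
  by rewrite (ell2_normB_sym R (gbar y)) (splitr d); exact: ltrD vd gw.
(* Evaluation at [w] after [Phi]; membership in the fiber says that its coordinates are those of
   [g w]. *)
pose phi : {linear Au R -> R[i]} :=
  HB.pack (ev w) (GRing.isLinear.Build R[i] (Au R) R[i] *:%R (ev w) (evlin w)).
have wd : ell2_norm (g w - gbar y) < d.
  by apply: lt_trans gw _; rewrite ltr_pdivrMr// ltr_pMr// ltr1n.
have := dP phi (g w) v _ _ _ wd vy.
rewrite DE CgE => /(_ _ _ _) H.
rewrite -(subrK (f v) (Phi f w)) -addrA (splitr e).
apply: le_trans (normc_triangle _ _) _; apply: lerD => //; apply: H.
- by move=> h k; rewrite /= /ev PM.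
- by rewrite /= /ev P1.
- by move=> n; rewrite /= /ev -[RHS](congr1 (@^~ n) (Pxi w)).
Qed.
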